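(* Let $H$ be a Hilbert space, let $S,T>0$, and let $L:H\times H\to\mathbb{R}$ be an anti-selfdual Lagrangian that is uniformly convex in the first variable. If $x_0\in\mathrm{Dom}_1(\partial L)$, then there exists $\hat x(\cdot,\cdot)\in A^2([0,S];L^2_H([0,T]))$ such that $\hat x(s,\cdot)\in A^2_H([0,T])$ for almost all $s\in[0,S]$ and $$\begin{aligned}0=&\int_0^S\!\!\int_0^T L\Big(\hat x(s,t),\frac{\partial\hat x}{\partial t}(s,t)+\frac{\partial\hat x}{\partial s}(s,t)\Big)\,dt\,ds\\&+\int_0^S\Big(\tfrac12\|\hat x(s,0)\|_H^2-2\langle\hat x(s,0),x_0\rangle+\|x_0\|_H^2+\tfrac12\|\hat x(s,T)\|_H^2\Big)ds\\&+\int_0^T\Big(\tfrac12\|\hat x(0,t)\|_H^2-2\langle\hat x(0,t),x_0\rangle+\|x_0\|_H^2+\tfrac12\|\hat x(S,t)\|_H^2\Big)dt.\end{aligned}$$ Furthermore, for almost all $(s,t)\in[0,S]\times[0,T]$, $$-\frac{\partial\hat x}{\partial t}(s,t)-\frac{\partial\hat x}{\partial s}(s,t)\in\partial_1L\Big(\hat x(s,t),\frac{\partial\hat x}{\partial t}(s,t)+\frac{\partial\hat x}{\partial s}(s,t)\Big),$$ $$-\hat x(s,t)\in\partial_2L\Big(\hat x(s,t),\frac{\partial\hat x}{\partial t}(s,t)+\frac{\partial\hat x}{\partial s}(s,t)\Big),$$ and $\hat x(0,t)=x_0$ for a.e. $t\in[0,T]$, $\hat x(s,0)=x_0$ for a.e.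 $s\in[0,S]$.
   Context: A convex lower semi-continuous functional $L$ on $H\times H$ is an anti-selfdual (ASD) Lagrangian if $L^*(p,x)=L(-x,-p)$ for all $(x,p)\in H\times H$, where $L^*(p,x)=\sup_{(y,q)\in H\times H}\{\langle p,y\rangle+\langle x,q\rangle-L(y,q)\}$. $L$ is uniformly convex in the first variable if for every $p$ the function $x\mapsto L(x,p)$ is uniformly convex (in the usual sense for convex functions). $\partial L$ is the convex subdifferential on $H\times H$; $\partial_1L(x,p)$ and $\partial_2L(x,p)$ are the partial subdifferentials in the first and second variable. $\mathrm{Dom}_1(\partial L)=\{x\in H:\ \text{there exists }p\in H\text{ such that }-(p,x)\in\partial L(x,p)\}$. For a Hilbert space $K$, $A^2([0,S];K)=A^2_K([0,S])$ is the space of absolutely continuous $u:[0,S]\to K$ with $\dot u\in L^2([0,S];K)$; $L^2_H([0,T])=L^2([0,T];H)$. One writes $\hat x(s,t)=\hat x(s)(t)$; $\partial\hat x/\partial s$ is the derivative of $s\mapsto\hat x(s,\cdot)$ in $L^2_H([0,T])$ and $\partial\hat x/\partial t$ the derivative of $t\mapsto\hat x(s,t)$. *)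

(* Defs.v *)
From HB Require Import structures.
From mathcomp Require Import all_boot all_order all_algebra generic_quotient.
From mathcomp Require Import ring_quotient sesquilinear.
From mathcomp Require Import all_classical all_reals all_analysis.
From mathcomp Require Import measurable_realfun.
Import numFieldNormedType.Exports.

Set Implicit Arguments.
Unset Strict Implicit.
Unset Printing Implicit Defensive.

Import Order.TTheory GRing.Theory Num.Theory.

Local Open Scope classical_set_scope.
Local Open Scope ring_scope.

HB.mixin Record CompleteNormedModule_isHilbert (R : realType) H
    & CompleteNormedModule R H := {
  inner : {dot H for @idfun R} ;
  innerE : forall x : H, inner x x = `|x| ^+ 2
}.

#[short(type="hilbertType")]
HB.structure Definition Hilbert (R : realType) :=
  {H of CompleteNormedModule_isHilbert R H & CompleteNormedModule R H}.

Section convex.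
Context {R : realType}.

(* Real-valued moduli suffice because [f] is finite. *)
Definition uniformly_convex (H : normedModType R) (f : H -> R) :=
  exists phi : R -> R,
    [/\ {in `[0, +oo[ &, {homo phi : r s / r <= s}},
        phi 0 = 0, (forall r, 0 < r -> 0 < phi r) &
        forall (x y : H) (t : R), 0 <= t <= 1 ->
          f (t *: x + (1 - t) *: y) + t * (1 - t) * phi `|x - y|
            <= t * f x + (1 - t) * f y].

Context {H : hilbertType R}.
Implicit Types (L : H * H -> R) (x p q y : H).

(* The first argument of [conjugate L] is dual to the first variable of [L]. *)
Definition conjugate L p x : \bar R :=
  ereal_sup [set (inner p z.1 + inner x z.2 - L z)%:E | z in [set: H * H]].

Definition ASD L :=
  [/\ convex_function [set: convex_lmodType (H * H)%type] L,
      lower_semicontinuous (EFin \o L) &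
      forall x p, conjugate L p x = (L (- x, - p))%:E].

(* Subdifferential of a function of one variable; the partial subdifferentials
   of [L] at [(x, p)] are [subdiff1 (fun y => L (y, p)) x] and
   [subdiff1 (fun q => L (x, q)) p]. *)
Definition subdiff1 (f : H -> R) x : set H :=
  [set q | forall y, f x + inner q (y - x) <= f y].

Definition subdiff L (z : H * H) : set (H * H) :=
  [set w | forall z' : H * H,
     L z + (inner w.1 (z'.1 - z.1) + inner w.2 (z'.2 - z.2)) <= L z'].

Definition Dom1 L : set H := [set x | exists p, subdiff L (x, p) (- p, - x)].

End convex.

Section strong_measurability.
Context {R : realType} d (X : measurableType d) (V : normedModType R).
Implicit Types (D : set X) (f g : X -> V).

Definition simple g :=
  exists (n : nat) (A : 'I_n -> set X) (v : 'I_n -> V),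
    (forall i, measurable (A i)) /\
    g = (fun x => \sum_(i < n) \1_(A i) x *: v i).

(* Bochner measurability with convergence everywhere on [D] rather than almost
   everywhere: every class of almost everywhere equal functions that contains a
   Bochner measurable function contains one that is measurable in this sense. *)
Definition strongly_measurable D f :=
  exists2 g : nat -> X -> V, (forall n, simple (g n)) &
    forall x, D x -> g n x @[n --> \oo] --> f x.

Lemma simpleD f g : simple f -> simple g -> simple (f + g).
Proof.
move=> [n [A [v [mA ->]]]] [m [B [w [mB ->]]]].
exists (n + m)%N, (fun i : 'I_(n + m) => match fintype.split i with inl j => A j | inr j => B j end),
  (fun i : 'I_(n + m) => match fintype.split i with inl j => v j | inr j => w j end); split.
  by move=> i; case: (fintype.split i).
apply/funext => x; rewrite fctE big_split_ord; congr (_ + _);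
  apply: eq_bigr => i _.
  by have /= -> := unsplitK (inl i : 'I_n + 'I_m).
by have /= -> := unsplitK (inr i : 'I_n + 'I_m).
Qed.

Lemma simpleZ (a : R) f : simple f -> simple (a *: f).
Proof.
move=> [n [A [v [mA ->]]]]; exists n, A, (fun i => a *: v i); split => //.
apply/funext => x; rewrite scalrfctE scaler_sumr; apply: eq_bigr => i _.
by rewrite !scalerA mulrC.
Qed.

Lemma simple_norm g : simple g -> measurable_fun setT (fun x => `|g x|).
Proof.
move=> [n [A [v [mA ->]]]].
suff H w : measurable_fun setT
    (fun x => `|w + \sum_(i < n) \1_(A i) x *: v i|).
  by have := H 0; under eq_fun do rewrite add0r.
elim: n A v mA w => [|n IH] A v mA w.
  by under eq_fun do rewrite big_ord0 addr0; exact: measurable_cst.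
pose S x := \sum_(i < n) \1_(A (lift ord0 i)) x *: v (lift ord0 i).
have mS w' : measurable_fun setT (fun x => `|w' + S x|).
  by apply: IH => i; exact: mA.
rewrite (_ : (fun x => _) = (fun x =>
    if x \in A ord0 then `|(w + v ord0) + S x| else `|w + S x|)).
  apply: measurable_fun_ifT => //; apply: (measurable_fun_bool true).
  rewrite setTI (_ : _ @^-1` _ = A ord0)//.
  by apply/seteqP; split=> x /= => [/set_mem|/mem_set].
apply/funext => x; rewrite big_ord_recl indicE.
by case: (x \in A ord0); rewrite ?scale1r ?scale0r ?addrA ?addr0.
Qed.

Lemma strongly_measurableD D f g : strongly_measurable D f ->
  strongly_measurable D g -> strongly_measurable D (f + g).
Proof.
move=> [f_ sf cf] [g_ sg cg]; exists (fun n => f_ n + g_ n).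
  by move=> n; exact: simpleD.
by move=> x Dx; exact: cvgD (cf x Dx) (cg x Dx).
Qed.

Lemma strongly_measurableZ D (a : R) f : strongly_measurable D f ->
  strongly_measurable D (a *: f).
Proof.
move=> [f_ sf cf]; exists (fun n => a *: f_ n).
  by move=> n; exact: simpleZ.
by move=> x Dx; exact: cvgZr (cf x Dx).
Qed.

Lemma strongly_measurable0 D : strongly_measurable D 0.
Proof.
exists (fun=> 0) => [n|x _]; last exact: cvg_cst.
exists 0, (fun=> set0), (fun=> 0); split => //.
by apply/funext => x; rewrite big_ord0.
Qed.

Lemma strongly_measurable_norm D f : measurable D -> strongly_measurable D f ->
  measurable_fun D (fun x => `|f x|).
Proof.
move=> mD [g sg cg].
apply/measurable_EFinP.
apply: (emeasurable_fun_cvg (fun n x => `|g n x|%:E)) => [n|x Dx].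
  apply/measurable_EFinP; exact: measurable_funS (simple_norm (sg n)).
by apply: cvg_EFin; [exact: nearW|apply: cvg_norm; exact: cg].
Qed.

End strong_measurability.

Section L2.
Context {R : realType}.
Local Notation leb := (@lebesgue_measure R).

Definition norm_on (V : normedModType R) (a : R) (f : R -> V) : R -> R :=
  (fun t => `|f t|) \_ `[0, a].

(* Square-integrable functions on [[0, a]]: the values outside [[0, a]] are
   irrelevant. *)
Definition L2fun (V : normedModType R) (a : R) : set (R -> V) :=
  [set f | strongly_measurable `[0, a] f /\ finite_norm leb 2%:E (norm_on a f)].

Section norm.
Context (V : normedModType R) (a : R).
Implicit Types f g : R -> V.

Lemma norm_on_ge0 f t : 0 <= norm_on a f t.
Proof. by rewrite /norm_on patchE; case: ifP. Qed.

Lemma measurable_norm_on f : strongly_measurable `[0, a] f ->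
  measurable_fun setT (norm_on a f).
Proof.
move=> mf; apply/(measurable_restrictT _ (measurable_itv _)).
exact: strongly_measurable_norm.
Qed.

Lemma norm_onD f g t : norm_on a (f + g) t <= norm_on a f t + norm_on a g t.
Proof.
by rewrite /norm_on !patchE; case: ifP => _; [exact: ler_normD|rewrite addr0].
Qed.

Lemma norm_onZ (k : R) f : norm_on a (k *: f) = `|k| \*: norm_on a f.
Proof.
apply/funext => t; rewrite /norm_on /= !patchE.
by case: ifP => _; [exact: normrZ|rewrite scaler0].
Qed.

Lemma norm_on_Lfun f : L2fun a f -> norm_on a f \in Lfun leb 2%:E.
Proof.
by move=> [mf ff]; apply/andP; split; rewrite inE//=; exact: measurable_norm_on.
Qed.

Lemma Lnorm2E (h : R -> R) : ('N[leb]_2%:E[EFin \o h] =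
  (\int[leb]_t (`|h t| `^ 2)%:E) `^ 2^-1)%E.
Proof. by rewrite unlock. Qed.

Lemma measurable_powR2 (h : R -> R) : measurable_fun setT h ->
  measurable_fun setT (fun t => (`|h t| `^ 2)%:E).
Proof.
move=> mh; apply/measurable_EFinP.
apply: (@measurableT_comp _ _ _ _ _ _ (@powR R ^~ 2)) => //.
exact: measurableT_comp.
Qed.

Lemma Lnorm_norm_onD f g : L2fun a f -> L2fun a g ->
  ('N[leb]_2%:E[EFin \o norm_on a (f + g)%R] <=
   'N[leb]_2%:E[EFin \o norm_on a f] + 'N[leb]_2%:E[EFin \o norm_on a g])%E.
Proof.
move=> [mf _] [mg _].
have mnf := measurable_norm_on mf; have mng := measurable_norm_on mg.
have mfg := measurable_norm_on (strongly_measurableD mf mg).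
apply: le_trans (eminkowski leb mnf mng _); last by rewrite lee1n.
rewrite !Lnorm2E; apply: gt0_ler_poweR; rewrite ?invr_ge0//.
1,2: by rewrite in_itv/= leey andbT; apply: integral_ge0 => t _;
  rewrite lee_fin powR_ge0.
apply: ge0_le_integral => //.
- exact: measurable_powR2.
- by apply: measurable_powR2; exact: measurable_funD.
move=> t _; rewrite lee_fin; apply: ge0_ler_powR; rewrite ?nnegrE//.
rewrite !ger0_norm ?addr_ge0 ?norm_on_ge0//; exact: norm_onD.
Qed.

Lemma Lnorm_norm_onZ (k : R) f : L2fun a f ->
  ('N[leb]_2%:E[EFin \o norm_on a (k *: f)%R] =
  `|k|%:E * 'N[leb]_2%:E[EFin \o norm_on a f])%E.
Proof.
move=> Lf; rewrite norm_onZ.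
by have := LnormZ (Lfun_Sub (lee1n 2) (norm_on_Lfun Lf)) `|k|; rewrite normr_id.
Qed.

Lemma Lnorm_norm_on_fin f : L2fun a f ->
  ('N[leb]_2%:E[EFin \o norm_on a f])%E \is a fin_num.
Proof. by move=> [_ ff]; rewrite ge0_fin_numE ?Lnorm_ge0. Qed.

Lemma Lnorm_norm_on_eq0 f : L2fun a f ->
  ('N[leb]_2%:E[EFin \o norm_on a f] = 0)%E <->
  {ae leb, forall t, t \in `[0, a] -> f t = 0}.
Proof.
move=> [mf ff]; split.
  move=> N0; have := Lnorm_eq0_eq0 _ _ N0.
  have mn : measurable_fun setT (EFin \o norm_on a f).
    by apply/measurable_EFinP; exact: measurable_norm_on.
  move=> /(_ mn); rewrite lte_fin ltr0n => /(_ isT).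
  apply: (@filterS _ _ (ae_filter_ringOfSetsType leb)) => t /(_ I); rewrite /= /norm_on patchE => + ta.
  by rewrite mem_set// => -[] /eqP; rewrite normr_eq0 => /eqP.
move=> f0.
rewrite Lnorm2E (_ : (\int[_]_x _)%E = 0%E) ?poweR0r ?invr_eq0//.
rewrite (_ : 0%E = \int[leb]_(x in setT) 0)%E; last by rewrite integral0.
apply: ae_eq_integral => //.
  by apply: measurable_powR2; exact: measurable_norm_on.
apply: (@filterS _ _ (ae_filter_ringOfSetsType leb)) f0 => t f0 _; rewrite /= /norm_on patchE.
by case: ifPn => [/set_mem ta|_]; rewrite ?f0// !normr0 powR0.
Qed.

Definition L2pred : {pred R -> V} := mem (L2fun a).

Lemma submod_closed_L2fun : submod_closed L2pred.
Proof.
have L0 : L2fun a (0 : R -> V).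
  split; first exact: strongly_measurable0.
  rewrite /finite_norm (_ : norm_on a 0 = cst 0) ?Lnorm0//.
  by apply/funext => t; rewrite /norm_on patchE normr0 if_same.
split=> [|k f g]; rewrite !inE// => Lf Lg.
have Lkf : L2fun a (k *: f).
  split; first by apply: strongly_measurableZ; case: Lf.
  rewrite /finite_norm Lnorm_norm_onZ// -(fineK (Lnorm_norm_on_fin Lf)).
  by rewrite -EFinM ltry.
split; first by apply: strongly_measurableD; [case: Lkf|case: Lg].
apply: le_lt_trans (Lnorm_norm_onD Lkf Lg) _.
by rewrite lte_add_pinfty//; [case: Lkf|case: Lg].
Qed.

HB.instance Definition _ := GRing.isSubmodClosed.Build _ _ L2pred
  submod_closed_L2fun.

End norm.

Section space.
Context (a : R) (V : normedModType R).

Record sqint := Sqint {sqint_val :> R -> V; _ : sqint_val \in @L2pred V a}.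

HB.instance Definition _ := [isSub for sqint_val].
HB.instance Definition _ := [Choice of sqint by <:].
HB.instance Definition _ := [SubChoice_isSubLmodule of sqint by <:].

Lemma sqintP (f : sqint) : L2fun a f.
Proof. by have := valP f; rewrite inE. Qed.

Definition ae0 : {pred sqint} :=
  mem [set f : sqint | {ae leb, forall t, t \in `[0, a] -> f t = 0}].

Let ae0E (f : sqint) :
  (f \in ae0) = ('N[leb]_2%:E[EFin \o norm_on a f] == 0)%E.
Proof.
apply/idP/eqP; rewrite inE/= => /(Lnorm_norm_on_eq0 (sqintP f)) //.
Qed.

Lemma zmod_closed_ae0 : zmod_closed ae0.
Proof.
have Z (k : R) (f : sqint) : f \in ae0 -> k *: f \in ae0.
  by rewrite !ae0E Lnorm_norm_onZ; [move=> /eqP ->; rewrite mule0|exact: sqintP].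
have D (f g : sqint) : f \in ae0 -> g \in ae0 -> f + g \in ae0.
  rewrite !ae0E => /eqP f0 /eqP g0; rewrite eq_le Lnorm_ge0 andbT.
  by apply: le_trans (Lnorm_norm_onD (sqintP f) (sqintP g)) _; rewrite f0 g0 adde0.
split=> [|f g f0 g0]; first by rewrite -(scale0r (0 : sqint)) Z//= inE; apply: nearW.
by rewrite -scaleN1r D ?Z.
Qed.

HB.instance Definition _ := GRing.isZmodClosed.Build _ ae0 zmod_closed_ae0.

Lemma ae0P (f : sqint) :
  reflect (('N[leb]_2%:E[EFin \o norm_on a f])%E = 0%E) (f \in ae0).
Proof. by rewrite ae0E; exact: eqP. Qed.

Lemma ae0Z (k : R) (f : sqint) : f \in ae0 -> k *: f \in ae0.
Proof.
by move=> /ae0P f0; apply/ae0P; rewrite Lnorm_norm_onZ ?f0 ?mule0//;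
  exact: sqintP.
Qed.

End space.
End L2.

(* L^2([0, a]; V), as the space of square-integrable functions modulo equality
   almost everywhere on [[0, a]], normed by the L^2 norm of |f|. *)
Definition L2 (R : realType) (a : R) (V : normedModType R) : Type :=
  Quotient.quot (@ae0 R a V).

HB.instance Definition _ (R : realType) (a : R) (V : normedModType R) :=
  ZmodQuotient.copy (L2 a V) (Quotient.quot (@ae0 R a V)).

Section L2_normed.
Context {R : realType} (a : R) (V : normedModType R).
Local Notation leb := (@lebesgue_measure R).
Implicit Types (f g : sqint a V) (F G : L2 a V).
Local Open Scope quotient_scope.

Lemma L2_eqP f g : reflect (f = g %[mod L2 a V]) (f - g \in ae0 (a:=a) (V:=V)).
Proof. by rewrite Quotient.idealrBE; exact: eqP. Qed.

Definition L2_scale (k : R) F : L2 a V := \pi_(L2 a V) (k *: repr F).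

Lemma L2_scale_pi k f : L2_scale k (\pi_(L2 a V) f) = \pi_(L2 a V) (k *: f).
Proof.
by apply/L2_eqP; rewrite -scalerBr ae0Z//; apply/L2_eqP; rewrite reprK.
Qed.

Let scaleA k l F : L2_scale k (L2_scale l F) = L2_scale (k * l) F.
Proof. by elim/quotW: F => f; rewrite (L2_scale_pi l) !L2_scale_pi scalerA. Qed.

Let scale1 : left_id 1 L2_scale.
Proof. by elim/quotW => f; rewrite L2_scale_pi scale1r. Qed.

Let scaleDr : right_distributive L2_scale +%R.
Proof.
move=> k F G; elim/quotW: F => f; elim/quotW: G => g.
by rewrite -raddfD !L2_scale_pi -raddfD scalerDr.
Qed.

Let scaleDl F : {morph L2_scale ^~ F : k l / k + l}.
Proof.
by move=> k l; elim/quotW: F => f; rewrite !L2_scale_pi -raddfD scalerDl.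
Qed.

HB.instance Definition _ :=
  GRing.Zmodule_isLmodule.Build R (L2 a V) scaleA scale1 scaleDr scaleDl.

Definition sqint_norm f : R := fine 'N[leb]_2%:E[EFin \o norm_on a f]%E.

Let sqint_normE f : (sqint_norm f)%:E = 'N[leb]_2%:E[EFin \o norm_on a f]%E.
Proof. by rewrite fineK// Lnorm_norm_on_fin//; exact: sqintP. Qed.

Let sqint_normD f g : sqint_norm (f + g) <= sqint_norm f + sqint_norm g.
Proof.
by rewrite -lee_fin EFinD !sqint_normE Lnorm_norm_onD//; exact: sqintP.
Qed.

Definition L2_norm F : R := sqint_norm (repr F).

Lemma L2_norm_pi f : L2_norm (\pi_(L2 a V) f) = sqint_norm f.
Proof.
have le g h : g = h %[mod L2 a V] -> sqint_norm g <= sqint_norm h.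
  move=> /L2_eqP/ae0P gh; rewrite -[g](subrK h).
  by apply: le_trans (sqint_normD _ _) _; rewrite /sqint_norm gh/= add0r.
by apply/eqP; rewrite eq_le !le ?reprK.
Qed.

Let L2_normD F G : L2_norm (F + G) <= L2_norm F + L2_norm G.
Proof.
elim/quotW: F => f; elim/quotW: G => g.
by rewrite -raddfD !L2_norm_pi.
Qed.

Let L2_normZ k F : L2_norm (k *: F) = `|k| * L2_norm F.
Proof.
elim/quotW: F => f; rewrite [_ *: _]L2_scale_pi !L2_norm_pi.
apply: EFin_inj; rewrite EFinM !sqint_normE Lnorm_norm_onZ//; exact: sqintP.
Qed.

Let L2_norm0 F : L2_norm F = 0 -> F = 0.
Proof.
elim/quotW: F => f; rewrite L2_norm_pi => f0.
rewrite -[RHS](raddf0 \pi_(L2 a V)); apply/L2_eqP; rewrite subr0.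
by apply/ae0P; rewrite -sqint_normE f0.
Qed.

HB.instance Definition _ :=
  @Lmodule_isNormed.Build R (L2 a V) L2_norm L2_normD L2_normZ L2_norm0.

Definition represents (f : R -> V) F :=
  {ae leb, forall t, t \in `[0, a] -> f t = repr F t}.

End L2_normed.

Section A2.
Context {R : realType} {K : normedModType R}.
Local Notation leb := (@lebesgue_measure R).
Implicit Types (a : R) (u : R -> K).

Definition absolutely_continuous a u :=
  forall e, 0 < e -> exists2 d, 0 < d &
    forall (n : nat) (l r : 'I_n -> R),
      (forall i, 0 <= l i <= r i /\ r i <= a) ->
      trivIset setT (fun i => `]l i, r i[%classic) ->
      \sum_(i < n) (r i - l i) < d ->
      \sum_(i < n) `|u (r i) - u (l i)| < e.

(* A^2([0, a]; K). When K is a Hilbert space an absolutely continuous function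
   is differentiable almost everywhere, so the existence of the derivative is
   not an extra condition. *)
Definition A2 a u :=
  absolutely_continuous a u /\
  exists2 du, L2fun a du &
    {ae leb, forall s, s \in `[0, a] -> is_derive s 1 u (du s)}.

End A2.

(* Main.v *)
(** The equation is solved along its characteristics.  The set [G] of the pairs
    [(x, p)] with [L (x, p) = - <x, p>] is, up to the sign of [p], the graph of
    a maximal monotone operator [A]: minimising
    [L (x, p) + <z, p> + |x - z|^2 / (2 l) + l |p|^2 / 2] yields the resolvent
    of [A], because self-duality forces [x = z + l p] and [(x, p) \in G] at the
    minimiser.  If [y' \in - A y] and [y 0 = x0], then
    [x(s, t) = y (min s t)] satisfies [x_t + x_s \in - A x] off the diagonal
    and equals [x0] on both axes.

    The curve [y] is the limit of the implicit Euler scheme with steps [4^-n].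
    No Radon-Nikodym property is needed for [y']: writing [d t] for the element
    of least norm of [- A (y t)], the function [|d|] is nonincreasing, and [y]
    is differentiable at every point of continuity of [|d|], that is, off a
    countable set.  The energy identity is then the fundamental theorem of
    calculus for [|x|^2 / 2] in each variable, combined with Fubini's theorem. *)

Require Import Defs.
From mathcomp Require Import all_boot all_order all_algebra sesquilinear.
From mathcomp Require Import all_classical all_reals all_analysis.
From mathcomp Require Import measurable_realfun ring lra.
Import numFieldNormedType.Exports.

Set Implicit Arguments.
Unset Strict Implicit.
Unset Printing Implicit Defensive.

Import Order.TTheory GRing.Theory Num.Theory.

Local Open Scope classical_set_scope.
Local Open Scope ring_scope.

(** On the graph, [L] equals minus the power [<x, x_t + x_s>], so its double integral reduces to
    boundary energies; since [x = x0] on both axes, each boundary integrand collapses to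
    [(|x|^2 - |x0|^2) / 2] and everything cancels.

    The obstacle is regularity: monotonicity gives a Lipschitz [y], whose difference quotients are
    merely bounded. A quotient starting at time [b] has norm at most [|d b|], and its squared
    distance to a Yosida value is at most a difference of squared norms plus a small error. Control
    of norms therefore forces strong convergence, and only the left limits of [|d|] can obstruct it.

    Exceptional sets are kept countable rather than null: all their subsets are measurable, so
    derivatives and integrands may be changed on them freely, as a notion of measurability with
    convergence everywhere requires. *)

Section inner_product.
Context {R : realType} {H : hilbertType R}.
Implicit Types (x y z : H) (a : R).

Lemma innerC x y : inner x y = inner y x.
Proof. by rewrite hermC /= expr0 mul1r. Qed.

Lemma innerDl x y z : inner (x + y) z = inner x z + inner y z.
Proof. exact: linearDl. Qed.

Lemma innerNl x y : inner (- x) y = - inner x y.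
Proof. exact: linearNl. Qed.

Lemma innerZl a x y : inner (a *: x) y = a * inner x y.
Proof. exact: linearZl_LR. Qed.

Lemma innerDr x y z : inner x (y + z) = inner x y + inner x z.
Proof. by rewrite innerC innerDl !(innerC x). Qed.

Lemma innerNr x y : inner x (- y) = - inner x y.
Proof. by rewrite innerC innerNl innerC. Qed.

Lemma innerZr a x y : inner x (a *: y) = a * inner x y.
Proof. by rewrite innerC innerZl innerC. Qed.

Definition innerLR := (innerDl, innerDr, innerNl, innerNr, innerZl, innerZr).

Lemma inner_ge0 x : 0 <= inner x x.
Proof. by rewrite innerE exprn_ge0. Qed.

Lemma inner_le x y : inner x y <= `|x| * `|y|.
Proof.
have : `|x + y| ^+ 2 <= (`|x| + `|y|) ^+ 2.
  by rewrite lerXn2r ?nnegrE ?addr_ge0// ler_normD.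
rewrite sqrrD -!innerE !innerLR (innerC y x); lra.
Qed.

Lemma inner_norm_le x y : `|inner x y| <= `|x| * `|y|.
Proof.
rewrite ler_norml inner_le andbT lerNl -innerNl.
by rewrite -(normrN x) inner_le.
Qed.

Lemma cvg_inner (x_ y_ : nat -> H) x y : x_ n @[n --> \oo] --> x ->
  y_ n @[n --> \oo] --> y -> inner (x_ n) (y_ n) @[n --> \oo] --> inner x y.
Proof.
have E (u v : H) : inner u v = 2^-1 * (`|u + v| ^+ 2 - `|u| ^+ 2 - `|v| ^+ 2).
  by rewrite -!innerE !innerLR (innerC v u); lra.
have sqr (u_ : nat -> H) (u : H) : u_ n @[n --> \oo] --> u ->
    `|u_ n| ^+ 2 @[n --> \oo] --> `|u| ^+ 2.
  by move=> /cvg_norm cu; exact: (cvgM cu cu).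
move=> xl yl; rewrite E; under eq_cvg do rewrite E.
apply: cvgM; first exact: cvg_cst.
apply: cvgB; last exact: sqr.
by apply: cvgB; apply: sqr => //; exact: cvgD.
Qed.

Lemma ler_sqr_norm x (c : R) : 0 <= c -> inner x x <= c ^+ 2 -> `|x| <= c.
Proof. by move=> c0; rewrite innerE ler_pXn2r// nnegrE. Qed.

End inner_product.

(** * Self-dual Lagrangians and their monotone graph *)

Section self_dual.
Context {R : realType} {H : hilbertType R} (L : H * H -> R).
Hypothesis asdL : ASD L.
Implicit Types (x y z p q u v w : H).

(* [(x, p)] lies in this set iff [- p] lies in the value at [x] of the maximal
   monotone operator encoded by [L]. *)
Definition flow_graph : set (H * H) := [set z | L z = - inner z.1 z.2].
Local Notation G := flow_graph.

(** The Fenchel-Young inequality, with the conjugate at [(u, v)] eliminated by self-duality. *)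
Lemma ASD_fenchel x p u v : inner u x + inner v p - L (x, p) <= L (- v, - u).
Proof.
case: asdL => _ _ dL; rewrite -lee_fin -dL.
by apply: ereal_sup_ubound; exists (x, p).
Qed.

(** The equality case of Fenchel-Young: for a subgradient [(u, v)] the supremum in the conjugate is
    attained at [(x, p)]. *)
Lemma ASD_subgradient x p u v :
  (forall y q, L (x, p) + (inner u (y - x) + inner v (q - p)) <= L (y, q)) ->
  L (x, p) + L (- v, - u) <= inner u x + inner v p.
Proof.
case: asdL => _ _ dL sub; rewrite addrC -lerBrDr -lee_fin -dL.
apply: ge_ereal_sup => _ [[y q] _ <-] /=; rewrite lee_fin.
by have := sub y q; rewrite !innerLR; lra.
Qed.

(** Fenchel-Young at the dual point [(- p, - x)], where both values of [L] coincide. *)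
Lemma ASD_ge x p : - inner x p <= L (x, p).
Proof.
have := ASD_fenchel x p (- p) (- x).
by rewrite !opprK !innerLR (innerC p x); lra.
Qed.

Lemma flow_graph_subdiff x p : G (x, p) -> subdiff L (x, p) (- p, - x).
Proof.
rewrite /G/= => Lxp [y q]/=; have := ASD_fenchel y q (- p) (- x).
by rewrite !opprK Lxp !innerLR (innerC p x); lra.
Qed.

Lemma subdiff_flow_graph x p : subdiff L (x, p) (- p, - x) -> G (x, p).
Proof.
move=> sub; have := @ASD_subgradient x p (- p) (- x) (fun y q => sub (y, q)).
have := ASD_ge x p.
by rewrite /G/= !opprK !innerLR (innerC p x); lra.
Qed.

Lemma ASD_convex (t : R) (z w : H * H) : 0 <= t -> t <= 1 ->
  L (t *: z + (1 - t) *: w) <= t * L z + (1 - t) * L w.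
Proof.
move=> t0 t1; case: asdL => cL _ _.
have ti : Itv.spec (@Itv.num_sem R) (Itv.Real `[0%Z, 1%Z]) t.
  by rewrite /= /Itv.num_sem /= num_real/= in_itv/= t0.
exact: (cL (Itv.mk ti) z w (in_setT _) (in_setT _)).
Qed.

(** Convexity bounds [L] at the midpoint from above and [ASD_ge] bounds it from below; the upper
    bound minus the lower one is [- inner (p - q) (x - y) / 4]. *)
Lemma flow_graph_monotone x p y q : G (x, p) -> G (y, q) ->
  inner (p - q) (x - y) <= 0.
Proof.
rewrite /G/= => Lx Ly.
have h0 : 0 <= 2^-1 :> R by rewrite invr_ge0.
have h1 : 2^-1 <= 1 :> R by rewrite invf_le1//; lra.
have := ASD_convex (x, p) (y, q) h0 h1.
have := ASD_ge (2^-1 *: x + (1 - 2^-1) *: y) (2^-1 *: p + (1 - 2^-1) *: q).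
rewrite Lx Ly !innerLR (innerC p) (innerC q) (innerC p) (innerC q) => h /(le_trans h).
lra.
Qed.

(** The bounds [c_] may vary with [n] because in both applications they contain inner products of
    the approximating points. *)
Lemma ASD_lsc (z_ : nat -> H * H) (z : H * H) (c_ : nat -> R) (c : R) :
  z_ n @[n --> \oo] --> z -> c_ n @[n --> \oo] --> c ->
  (forall n, L (z_ n) <= c_ n) -> L z <= c.
Proof.
move=> zl cl Lc; case: asdL => _ scL _.
apply/ler_addgt0Pl => e e0; rewrite addrC -lerBlDr.
have [|V nV Vz] := scL z (L z - e).
  by rewrite /= lte_fin ltrBlDr ltrDl.
rewrite -(cvg_lim _ cl)//; apply: limr_ge; first by apply: cvgP; exact: cl.
have VN : \forall n \near \oo, V (z_ n) by exact: zl.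
near=> n; apply: le_trans (Lc n); apply: ltW; rewrite -lte_fin.
by apply: Vz; near: n.
Unshelve. all: by end_near.
Qed.

End self_dual.

Lemma cauchy_seq_cvg (R : realType) (V : completeNormedModType R)
    (u : nat -> V) :
  (forall e, 0 < e -> exists N, forall m n, (N <= m)%N -> (N <= n)%N ->
    `|u m - u n| <= e) -> cvgn u.
Proof.
move=> uc; apply: cauchy_cvg; apply: cauchy_exP => e e0.
have e20 : 0 < e / 2 by rewrite divr_gt0.
have [N uN] := uc _ e20; exists (u N).
exists N => // n /= Nn; rewrite -ball_normE /ball_/=.
by apply: le_lt_trans (uN _ _ (leqnn N) Nn) _; rewrite ltr_pdivrMr// ltr_pMr// ltr1n.
Qed.

Lemma ge0_of_small_perturbation (R : realFieldType) (a b : R) : 0 <= b ->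
  (forall t, 0 < t -> t <= 1 -> 0 <= a + t * b) -> 0 <= a.
Proof.
move=> b0 ab; rewrite leNgt; apply/negP => a0.
(* This [t] makes [t * b <= - a / 2], hence [a + t * b < 0]. *)
pose t := Num.min 1 (- a / (2 * (b + 1))).
have d0 : 0 < 2 * (b + 1) by rewrite mulr_gt0// ltr_wpDl.
have t0 : 0 < t by rewrite lt_min ltr01 divr_gt0// oppr_gt0.
have t1 : t <= 1 by rewrite ge_min lexx.
have := ab t t0 t1.
have : t * (2 * (b + 1)) <= - a by rewrite -ler_pdivlMr// ge_min lexx orbT.
nra.
Qed.

(** * Resolvents by minimisation *)

Section resolvent.
Context {R : realType} {H : hilbertType R} (L : H * H -> R).
Hypothesis asdL : ASD L.
Implicit Types (x y z p q : H) (l : R).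
Local Notation G := (flow_graph L).

(** Equals [(L w + inner w.1 w.2) + |w.1 - z - l w.2|^2 / (2 l)], a sum of two nonnegative terms
    that both vanish exactly at the resolvent pair. In the form chosen here, convexity is visible
    term by term. *)
Let cost l z (w : H * H) : R := L w + inner z w.2 +
  (2 * l)^-1 * inner (w.1 - z) (w.1 - z) + l / 2 * inner w.2 w.2.

Let cost_ge0 l z w : 0 < l -> 0 <= cost l z w.
Proof.
move=> l0; have := ASD_ge asdL w.1 w.2; case: w => x p /=.
have := inner_ge0 (x - z - l *: p).
rewrite /cost/= !innerLR (innerC p x) (innerC z x) (innerC p z) => q0.
have l20 : 0 <= (2 * l)^-1 by rewrite invr_ge0 mulr_ge0// ltW.
have {q0} := mulr_ge0 l20 q0.
set a := inner x x; set b := inner x z; set c := inner z z.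
set d := inner x p; set e := inner z p; set f := inner p p.
move=> q0 Lge.
have : 0 <= (2 * l)^-1 * (a - 2 * b + c) - d + e + l / 2 * f.
  by move: q0; congr (is_true (0 <= _)); field; rewrite lt0r_neq0.
lra.
Qed.

(** The parallelogram law for the two quadratic terms, [L] contributing midpoint convexity only. It
    makes minimising sequences Cauchy. *)
Let cost_mid l z (v w : H * H) : 0 < l ->
  (8 * l)^-1 * inner (v.1 - w.1) (v.1 - w.1) +
    l / 8 * inner (v.2 - w.2) (v.2 - w.2) <=
  (cost l z v + cost l z w) / 2 - cost l z (2^-1 *: v + (1 - 2^-1) *: w).
Proof.
move=> l0; have h0 : 0 <= 2^-1 :> R by rewrite invr_ge0.
have h1 : 2^-1 <= 1 :> R by rewrite invf_le1//; lra.
have := ASD_convex asdL v w h0 h1; rewrite /cost/=.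
set c := L (_ + _); move: v w c => [x p] [y q] c /=; rewrite -/c => cle.
rewrite !innerLR (innerC y x) (innerC z x) (innerC z y) (innerC q p).
rewrite -subr_ge0.
rewrite (_ : _ - _ = 2^-1 * L (x, p) + (1 - 2^-1) * L (y, q) - c).
  by rewrite subr_ge0.
by field; rewrite lt0r_neq0.
Qed.

Let cost_min l z : 0 < l -> exists w, forall v, cost l z w <= cost l z v.
Proof.
move=> l0; pose A := range (cost l z).
have hA : has_inf A.
  split; first by exists (cost l z 0); exists 0.
  by exists 0 => _ [w _ <-]; exact: cost_ge0.
have mA v : inf A <= cost l z v by apply: ge_inf; [exact: hA.2|exists v].
have n0 n : 0 < n.+1%:R^-1 :> R by rewrite invr_gt0.
have wP n : exists w, cost l z w < inf A + n.+1%:R^-1.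
  by have [_ [w _ <-]] := inf_adherent (n0 n) hA; exists w.
have [w wlt] := choice wP.
pose k := Num.min (8 * l)^-1 (l / 8).
have k0 : 0 < k by rewrite lt_min invr_gt0 ?mulr_gt0 ?divr_gt0.
have close m n : k * (inner ((w m).1 - (w n).1) ((w m).1 - (w n).1) +
    inner ((w m).2 - (w n).2) ((w m).2 - (w n).2)) <= m.+1%:R^-1 + n.+1%:R^-1.
  rewrite mulrDr.
  have := cost_mid z (w m) (w n) l0.
  have := mA (2^-1 *: w m + (1 - 2^-1) *: w n).
  move: (wlt m) (wlt n) (n0 m) (n0 n).
  have : k * inner ((w m).1 - (w n).1) ((w m).1 - (w n).1) <=
      (8 * l)^-1 * inner ((w m).1 - (w n).1) ((w m).1 - (w n).1).
    by rewrite ler_wpM2r ?inner_ge0// ge_min lexx.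
  have : k * inner ((w m).2 - (w n).2) ((w m).2 - (w n).2) <=
      l / 8 * inner ((w m).2 - (w n).2) ((w m).2 - (w n).2).
    by rewrite ler_wpM2r ?inner_ge0// ge_min lexx orbT.
  move: (cost l z _) (cost l z (w m)) (cost l z (w n)) (inf A) => c1 c2 c3 c4.
  move: (m.+1%:R^-1) (n.+1%:R^-1) => d1 d2.
  lra.
have small e : 0 < e -> exists N, forall n, (N <= n)%N -> n.+1%:R^-1 <= e :> R.
  move=> e0; exists (Num.truncn e^-1) => n Nn.
  rewrite invf_ple ?posrE//; apply: ltW; apply: (lt_le_trans (truncnS_gt _)).
  by rewrite ler_nat ltnS.
have cau (f : H * H -> H) :
    (forall m n, k * inner (f (w m) - f (w n)) (f (w m) - f (w n)) <=
       m.+1%:R^-1 + n.+1%:R^-1) -> cvgn (f \o w).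
  move=> fw; apply: cauchy_seq_cvg => e e0.
  have d0 : 0 < (k * e ^+ 2) / 2 by rewrite divr_gt0// mulr_gt0// exprn_gt0.
  have [N Ne] := small _ d0; exists N => m n /Ne mN /Ne nN.
  apply: ler_sqr_norm (ltW e0) _; rewrite -(ler_pM2l k0).
  apply: le_trans (fw m n) _; rewrite [leRHS]splitr; exact: lerD.
have /cvg_ex[x xl] : cvgn (fst \o w).
  apply: cau => m n; apply: le_trans (close m n).
  by rewrite ler_pM2l// lerDl inner_ge0.
have /cvg_ex[p pl] : cvgn (snd \o w).
  apply: cau => m n; apply: le_trans (close m n).
  by rewrite ler_pM2l// lerDr inner_ge0.
exists (x, p) => v; apply: le_trans (mA v).
have wl : w n @[n --> \oo] --> (x, p).
  rewrite (_ : w = fun n => ((w n).1, (w n).2)).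
    exact: (cvg_pair xl pl).
  by apply/funext => n; case: (w n).
(* The convergent terms of [cost] move to the right, so that semicontinuity is applied to [L]
   alone. *)
rewrite /cost -addrA -lerBrDr -lerBrDr.
apply: (@ASD_lsc _ _ _ asdL w _ (fun n => inf A + n.+1%:R^-1 - ((2 * l)^-1 *
   inner ((w n).1 - z) ((w n).1 - z) + l / 2 * inner (w n).2 (w n).2)
   - inner z (w n).2)) => //=.
  apply: cvgB; last by apply: cvg_inner; [exact: cvg_cst|exact: pl].
  apply: cvgB.
    rewrite -[X in _ --> X]addr0; apply: cvgD; first exact: cvg_cst.
    exact: cvg_harmonic.
  apply: cvgD; apply: cvgM; (try exact: cvg_cst); apply: cvg_inner;
   (try exact: pl); apply: cvgB; (try exact: cvg_cst); exact: xl.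
by move=> n; have := wlt n; rewrite /cost; move: (n.+1%:R^-1) (inf A) => d m0; lra.
Qed.

Lemma resolvent_exists l z : 0 < l -> exists p, G (z + l *: p, p).
Proof.
move=> l0; have [[x p] xmin] := cost_min z l0.
(* First-order condition at the minimiser: moving a fraction [t] towards [(y, q)], dividing by [t]
   and letting [t] tend to 0 removes the quadratic terms. *)
have sub y q : L (x, p) + (inner (- (l^-1 *: (x - z))) (y - x) +
    inner (- (z + l *: p)) (q - p)) <= L (y, q).
  rewrite -subr_ge0; set a := (X in 0 <= X).
  apply: (@ge0_of_small_perturbation _ a ((2 * l)^-1 * inner (y - x) (y - x) +
      l / 2 * inner (q - p) (q - p))).
    by rewrite addr_ge0// mulr_ge0 ?inner_ge0// ?invr_ge0 ?mulr_ge0 ?ltW.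
  move=> t t0 t1; have := xmin (t *: (y, q) + (1 - t) *: (x, p)).
  have := ASD_convex asdL (y, q) (x, p) (ltW t0) t1.
  rewrite /cost/=; set c := L (_ + _); rewrite -[c]/c => cle.
  rewrite -subr_ge0 => cge; rewrite -subr_ge0 in cle.
  rewrite -(pmulr_rge0 _ t0); apply: le_trans (addr_ge0 cle cge) _.
  rewrite le_eqVlt; apply/orP; left; apply/eqP; rewrite /a !innerLR.
  rewrite (innerC z x) (innerC z y) (innerC y x) (innerC q p).
  by field; rewrite lt0r_neq0.
have [u xE] : exists u, x = z + l *: u.
  by exists (l^-1 *: (x - z)); rewrite scalerA divff ?gt_eqF// scale1r addrC subrK.
have uE : l^-1 *: (x - z) = u.
  by rewrite xE addrAC subrr add0r scalerA mulVf ?gt_eqF// scale1r.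
(* Self-duality bounds [L (z + l u, p) + L (z + l p, u)] from above; subtracting the two lower
   bounds of [ASD_ge] leaves [l |u - p|^2 <= 0], so [x = z + l p]. *)
have := ASD_subgradient asdL sub.
rewrite !opprK uE xE; have := ASD_ge asdL (z + l *: p) u.
have := ASD_ge asdL (z + l *: u) p.
move=> h1 h2 h3.
have : l * inner (u - p) (u - p) <= 0.
  move: h1 h2 h3; rewrite !innerLR (innerC p u) (innerC u z); lra.
rewrite pmulr_rle0// => n0; have /eqP : `|u - p| ^+ 2 = 0.
  by apply/eqP; rewrite eq_le exprn_ge0// andbT -innerE.
rewrite expf_eq0/= normr_eq0 subr_eq0 => /eqP up.
exists p; rewrite /flow_graph/=; apply/eqP; rewrite eq_le.
move: h1 h2 h3; rewrite up !innerLR (innerC p z) => h1 h2 h3.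
by apply/andP; split; lra.
Qed.
End resolvent.

(** * Yosida approximation *)

Section yosida.
Context {R : realType} {H : hilbertType R} (L : H * H -> R).
Hypothesis asdL : ASD L.
Implicit Types (x y z w p q : H) (l m : R).
Local Notation G := (flow_graph L).

(* Minus the usual Yosida approximation of the maximal monotone operator. *)
Definition yosida l z : H := xget 0 [set p | G (z + l *: p, p)].

Definition resolvent l z : H := z + l *: yosida l z.

Local Notation P := yosida.
Local Notation J := resolvent.

Lemma resolvent_graph l z : 0 < l -> G (J l z, P l z).
Proof.
move=> l0; rewrite /resolvent /yosida; case: xgetP => [p -> //|none].
by have [p /none] := resolvent_exists asdL z l0.
Qed.

(** With the difference written [a + l b], monotonicity says [inner b (a + l b) <= 0], whence
    [|a + l b|^2 <= |a|^2 - l^2 |b|^2]. *)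
Lemma resolvent_le l z w : 0 < l -> `|J l z - J l w| <= `|z - w|.
Proof.
move=> l0; rewrite -(ler_pXn2r (n := 2))// ?nnegrE// -!innerE.
have := flow_graph_monotone asdL (resolvent_graph z l0) (resolvent_graph w l0).
have -> : J l z - J l w = (z - w) + l *: (P l z - P l w).
  by rewrite /resolvent opprD addrACA -scalerBr.
move: (z - w) (P l z - P l w) => a b.
rewrite !innerLR (innerC a b) => h; have := mulr_ge0 (ltW l0) (inner_ge0 b).
rewrite -(pmulr_rle0 _ l0) in h; nra.
Qed.

(** Monotonicity against [(x, p)] gives [|P l x|^2 <= inner (P l x) p]. As [p] is any element over
    [x], a limit of [P l x] lying over [x] has least norm. *)
Lemma yosida_le l x p : 0 < l -> G (x, p) -> `|P l x| <= `|p|.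
Proof.
move=> l0 Gxp; have := flow_graph_monotone asdL (resolvent_graph x l0) Gxp.
have -> : J l x - x = l *: P l x by rewrite /resolvent addrC addKr.
move: (P l x) => a; rewrite innerZr pmulr_rle0// !innerLR innerE (innerC p) => h.
have [->|a0] := eqVneq a 0; first by rewrite normr0.
have n0 : 0 < `|a| by rewrite normr_gt0.
rewrite -(ler_pM2l n0) -expr2; have := inner_le a p; lra.
Qed.

Lemma yosida_lipschitz l z w : 0 < l -> `|P l z - P l w| <= 2 / l * `|z - w|.
Proof.
move=> l0; rewrite mulrAC ler_pdivlMr// mulrC -{1}(gtr0_norm l0) -normrZ.
have -> : l *: (P l z - P l w) = (J l z - J l w) - (z - w).
  by rewrite /resolvent scalerBr opprD addrACA [RHS]addrC addKr.
apply: le_trans (ler_normB _ _) _; have := resolvent_le z w l0; lra.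
Qed.

(** For the two values [a] and [b], monotonicity reads [(m - l) inner (a - b) b >= l |a - b|^2]. *)
Lemma yosida_inner l m z : 0 < l -> l <= m ->
  inner (P m z) (P m z) <= inner (P l z) (P m z).
Proof.
move=> l0; rewrite le_eqVlt => /predU1P[->//|lm].
have m0 := lt_trans l0 lm.
have := flow_graph_monotone asdL (resolvent_graph z l0) (resolvent_graph z m0).
have -> : J l z - J m z = l *: P l z - m *: P m z.
  by rewrite /resolvent opprD addrACA subrr add0r.
move: (P l z) (P m z) => a b; have := inner_ge0 (a - b).
rewrite !innerLR (innerC b a) => h1 h2.
have {}h1 := mulr_ge0 (ltW l0) h1.
have lm0 : 0 < m - l by rewrite subr_gt0.
rewrite -subr_ge0 -(pmulr_rge0 _ lm0); nra.
Qed.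

(** Turns convergence of the norms [|P l z|] into strong convergence of [P l z] as [l] decreases. *)
Lemma yosida_close l m z : 0 < l -> l <= m ->
  inner (P l z - P m z) (P l z - P m z) <=
  inner (P l z) (P l z) - inner (P m z) (P m z).
Proof.
move=> l0 lm; have := yosida_inner z l0 lm.
by rewrite !innerLR (innerC (P m z)); lra.
Qed.

(** Halving a step [h] costs an error of order [sqrt (t h)] over a time [t]. With [h = 4^-n] this is
    of order [2^-n]: no square root appears and the errors are summable. *)
Definition step (n : nat) : R := (4^-1) ^+ n.

Lemma step_gt0 n : 0 < step n.
Proof. by rewrite exprn_gt0// invr_gt0. Qed.

Lemma step_le (m n : nat) : (m <= n)%N -> step n <= step m.
Proof. by move=> mn; rewrite ler_wiXn2l// ?invr_ge0// invf_le1//; lra. Qed.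

Lemma cvg_step : step n @[n --> \oo] --> 0.
Proof. by apply: cvg_expr; rewrite ger0_norm ?invr_ge0// invf_lt1//; lra. Qed.

(** The norms increase and stay bounded, so [yosida_close] yields a limit; since the resolvents tend
    to [x], semicontinuity of [L] puts that limit over [x]. *)
Lemma cvg_yosida x (N : R) : (forall l, 0 < l -> `|P l x| <= N) ->
  exists p, [/\ G (x, p), `|p| <= N & P (step n) x @[n --> \oo] --> p].
Proof.
move=> PN; have N0 : 0 <= N := le_trans (normr_ge0 _) (PN 1 ltr01).
pose a n := inner (P (step n) x) (P (step n) x).
have nda : nondecreasing_seq a.
  move=> m n mn; have := yosida_close x (step_gt0 n) (step_le mn).
  by have := inner_ge0 (P (step n) x - P (step m) x); rewrite /a; lra.
have cva : cvgn a.
  apply: nondecreasing_is_cvgn => //; exists (N ^+ 2) => _ [n _ <-].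
  by rewrite /a innerE lerXn2r ?nnegrE// PN// step_gt0.
have /cvg_ex[p pl] : cvgn (fun n => P (step n) x).
  apply: cauchy_seq_cvg => e e0.
  have e2 : 0 < e ^+ 2 by rewrite exprn_gt0.
  have /cvgrPdist_le/(_ _ e2)[M _ Ma] := cva.
  exists M => m n; wlog mn : m n / (m <= n)%N.
    move=> W Mm Mn; have /orP[mn|nm] := leq_total m n; first exact: W.
    by rewrite distrC; exact: W.
  move=> Mm Mn; rewrite distrC; apply: ler_sqr_norm (ltW e0) _.
  apply: le_trans (yosida_close x (step_gt0 n) (step_le mn)) _.
  rewrite -/(a n) -/(a m); have := Ma m Mm.
  have := nondecreasing_cvgn_le nda cva n; rewrite ler_norml => h /andP[_ h'].
  lra.
exists p; split => //; last first.
  rewrite -(cvg_lim _ (cvg_norm pl))//; apply: limr_le.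
    by apply: cvgP (cvg_norm pl).
  by apply: nearW => n; apply: PN; exact: step_gt0.
have Jl : J (step n) x @[n --> \oo] --> x.
  rewrite -[X in _ --> X]addr0; apply: cvgD; first exact: cvg_cst.
  by rewrite -(scale0r p); apply: cvgZ; [exact: cvg_step|exact: pl].
apply/eqP; rewrite eq_le; apply/andP; split; last exact: ASD_ge.
apply: (@ASD_lsc _ _ _ asdL (fun n => (J (step n) x, P (step n) x)) (x, p)
  (fun n => - inner (J (step n) x) (P (step n) x))).
- exact: cvg_pair Jl pl.
- by apply: cvgN; exact: cvg_inner.
- by move=> n; rewrite (resolvent_graph x (step_gt0 n)).
Qed.

End yosida.

Lemma cvgn_geometric (R : realType) (V : completeNormedModType R)
    (u : nat -> V) (C : R) :
  (forall n, `|u n.+1 - u n| <= C * 2^-1 ^+ n) -> cvgn u.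
Proof.
move=> uC; have C0 : 0 <= C.
  by have := le_trans (normr_ge0 _) (uC 0%N); rewrite expr0 mulr1.
have tel n k : `|u (n + k)%N - u n| <= 2 * C * (2^-1 ^+ n - 2^-1 ^+ (n + k)).
  elim: k => [|k IH]; first by rewrite addn0 !subrr normr0 mulr0.
  rewrite addnS -(subrKA (u (n + k)%N)).
  apply: le_trans (ler_normD _ _) _; have := uC (n + k)%N.
  rewrite exprS; lra.
apply: cauchy_seq_cvg => e e0.
have c2 : (2 * C + 1) * 2^-1 ^+ n @[n --> \oo] --> (2 * C + 1) * 0.
  apply: cvgM; [exact: cvg_cst|apply: cvg_expr].
  by rewrite ger0_norm ?invr_ge0// invf_lt1//; lra.
rewrite mulr0 in c2.
move/cvgr0Pnorm_le : c2 => /(_ _ e0)[M _ Me]; exists M.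
move=> m n; wlog mn : m n / (m <= n)%N.
  move=> W Mm Mn; have /orP[mn|nm] := leq_total m n; first exact: W.
  by rewrite distrC; exact: W.
move=> Mm _; rewrite distrC; apply: le_trans (Me m Mm).
rewrite -(subnKC mn); apply: le_trans (tel m _) _.
rewrite ger0_norm ?mulr_ge0 ?exprn_ge0 ?addr_ge0 ?mulr_ge0 ?invr_ge0//.
have : 0 <= 2^-1 ^+ m :> R by rewrite exprn_ge0.
have : 0 <= 2^-1 ^+ (m + (n - m)) :> R by rewrite exprn_ge0.
nra.
Qed.

(** * Implicit Euler scheme: refinement estimates *)

Section euler.
Context {R : realType} {H : hilbertType R} (L : H * H -> R).
Hypothesis asdL : ASD L.
Implicit Types (x y z w p q : H) (l h : R) (n k : nat).
Local Notation G := (flow_graph L).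
Local Notation P := (yosida L).
Local Notation J := (resolvent L).
Local Notation step := (@step R).

Definition euler h k x : H := iter k (J h) x.

Lemma eulerD h k j x : euler h (k + j) x = euler h k (euler h j x).
Proof. exact: iterD. Qed.

Lemma euler_le h k x y : 0 < h -> `|euler h k x - euler h k y| <= `|x - y|.
Proof.
move=> h0; elim: k => [//|k IH]; rewrite /euler !iterS.
exact: le_trans (resolvent_le asdL _ _ h0) IH.
Qed.

(** Each step replaces the current element by a Yosida value, which is no longer, so the initial
    speed bounds all later ones. *)
Lemma euler_graph h k x p : 0 < h -> G (x, p) ->
  exists2 q, G (euler h k x, q) & `|q| <= `|p|.
Proof.
move=> h0 Gx; elim: k => [|k [q Gq qp]]; first by exists p.
exists (P h (euler h k x)); first exact: resolvent_graph.
exact: le_trans (yosida_le asdL h0 Gq) qp.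
Qed.

Lemma yosida_euler_le l h k x p : 0 < l -> 0 < h -> G (x, p) ->
  `|P l (euler h k x)| <= `|p|.
Proof.
move=> l0 h0 Gx; have [q Gq] := euler_graph k h0 Gx.
exact: le_trans (yosida_le asdL l0 Gq).
Qed.

Lemma eulerS h k x : euler h k.+1 x = euler h k x + h *: P h (euler h k x).
Proof. by []. Qed.

Lemma eulerS_graph h k x : 0 < h -> G (euler h k.+1 x, P h (euler h k x)).
Proof. exact: resolvent_graph. Qed.

Lemma euler_dist h k x p : 0 < h -> G (x, p) ->
  `|euler h k x - x| <= k%:R * h * `|p|.
Proof.
move=> h0 Gx; elim: k => [|k IH]; first by rewrite subrr normr0 !mul0r.
rewrite eulerS addrAC; apply: le_trans (ler_normD _ _) _.
rewrite normrZ gtr0_norm// -natr1 !mulrDl mul1r.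
by rewrite lerD// ler_wpM2l ?(ltW h0)// yosida_euler_le.
Qed.

(** One coarse step is compared with two fine ones. Monotonicity handles the second fine step
    exactly, as its end point is the one being compared; the first ends [(h / 2) c] away, and this
    shift costs [(h |p|)^2] per coarse step. *)
Lemma euler_halve h k x p : 0 < h -> G (x, p) ->
  `|euler h k x - euler (h / 2) (2 * k) x| ^+ 2 <= k%:R * (h * `|p|) ^+ 2.
Proof.
move=> h0 Gx; have h20 : 0 < h / 2 by rewrite divr_gt0.
rewrite -innerE; elim: k => [|k IH].
  by rewrite muln0 subrr mul0r innerE normr0 expr0n.
rewrite mulnS add2n.
set u' := euler h k.+1 x; set v' := euler (h / 2) (2 * k).+1 x.
set v'' := euler (h / 2) (2 * k).+2 x.
pose a := P h (euler h k x); pose b := P (h / 2) (euler (h / 2) (2 * k) x).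
pose c := P (h / 2) v'.
have Ga : G (u', a) by exact: eulerS_graph.
have Gb : G (v', b) by exact: eulerS_graph.
have Gc : G (v'', c) by exact: eulerS_graph.
have na : `|a| <= `|p| by exact: yosida_euler_le.
have nb : `|b| <= `|p| by exact: yosida_euler_le.
have nc : `|c| <= `|p| by exact: yosida_euler_le.
have m1 := flow_graph_monotone asdL Ga Gb.
have m2 := flow_graph_monotone asdL Ga Gc.
have v''E : v'' = v' + (h / 2) *: c by [].
have E : u' - v'' = (euler h k x - euler (h / 2) (2 * k) x)
    + (h *: a - (h / 2) *: (b + c)).
  rewrite v''E (_ : u' = euler h k x + h *: a)//.
  rewrite (_ : v' = euler (h / 2) (2 * k) x + (h / 2) *: b)//.
  by rewrite scalerDr !opprD -[- _ - _ - _]addrA addrACA.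
set d := euler h k x - _ in IH E; set d' := u' - v''.
have dd' : d = d' - (h *: a - (h / 2) *: (b + c)) by rewrite /d' E addrK.
have n1 := inner_ge0 (h *: a - (h / 2) *: (b + c)).
have bc : inner b c <= `|p| ^+ 2.
  by apply: le_trans (inner_le _ _) _; rewrite expr2 ler_pM.
have ac : - inner a c <= `|p| ^+ 2.
  by rewrite -innerNl; apply: le_trans (inner_le _ _) _; rewrite normrN expr2 ler_pM.
(* Monotonicity is available for [u' - v'] only; replacing it by [d'] leaves the error
   [- (h / 2) inner (a - b) c]. *)
have m1' : inner (a - b) d' <= (h / 2) * (2 * `|p| ^+ 2).
  have -> : d' = (u' - v') - (h / 2) *: c by rewrite /d' v''E opprD addrA.
  rewrite innerDr innerNr innerZr.
  have -> : inner (a - b) c = inner a c - inner b c by rewrite innerDl innerNl.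
  have := ler_wpM2l (ltW h20) (lerD ac bc); lra.
(* Expansion of [|d|^2], with the square of the increment dropped. *)
have key : inner d' d' <= inner d d +
    h * (inner (a - b) d' + inner (a - c) d').
  move: n1; rewrite dd'; move: (d') => e.
  rewrite !innerLR (innerC e a) (innerC e b) (innerC e c).
  rewrite (innerC b a) (innerC c a) (innerC c b); nra.
apply: le_trans key _; rewrite -natr1 mulrDl mul1r.
apply: lerD IH _; rewrite exprMn expr2 -mulrA ler_pM2l//.
rewrite -/d' in m2; lra.
Qed.

(** Two halvings, each with error at most [sqrt k h |p|]. Since [k h <= t <= t^2], this is at most
    [t |p| 2^-n]; the condition [1 <= t] serves the inequality [t <= t^2]. *)
Lemma euler_quarter n k (t : R) x p : 1 <= t -> k%:R * step n <= t -> G (x, p) ->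
  `|euler (step n) k x - euler (step n.+1) (4 * k) x| <=
  2 * t * `|p| * 2^-1 ^+ n.
Proof.
move=> t1 kt Gx; have h0 := @step_gt0 R n; set h := step n in kt h0 *.
have hE : h = 2^-1 ^+ n * 2^-1 ^+ n.
  by rewrite /h /step -exprMn; congr (_ ^+ _); field.
have -> : step n.+1 = h / 2 / 2 by rewrite /h /step exprSr; field.
have -> : (4 * k = 2 * (2 * k))%N by rewrite mulnA.
have a0 : 0 <= t * `|p| * 2^-1 ^+ n.
  by rewrite !mulr_ge0 ?exprn_ge0 ?(le_trans ler01 t1).
have sq (c : R) : c <= k%:R * (h * `|p|) ^+ 2 -> c <= (t * `|p| * 2^-1 ^+ n) ^+ 2.
  move=> /le_trans; apply; rewrite [leRHS](_ : _ = t * t * (h * `|p| ^+ 2)); last first.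
    by rewrite hE; ring.
  rewrite [leLHS](_ : _ = k%:R * h * (h * `|p| ^+ 2)); last by ring.
  rewrite ler_wpM2r ?mulr_ge0 ?sqr_ge0 ?(ltW h0)//.
  by apply: le_trans kt _; rewrite ler_peMr// (le_trans ler01).
rewrite -(subrKA (euler (h / 2) (2 * k) x)).
apply: le_trans (ler_normD _ _) _.
rewrite (_ : 2 * _ * _ * _ = t * `|p| * 2^-1 ^+ n + t * `|p| * 2^-1 ^+ n); last by ring.
apply: lerD; rewrite -(ler_pXn2r (n := 2))// ?nnegrE//; apply: sq.
  exact: euler_halve.
apply: le_trans (euler_halve _ _ Gx) _; first by rewrite divr_gt0.
rewrite natrM; have : 0 <= k%:R * (h * `|p|) ^+ 2 by rewrite mulr_ge0// sqr_ge0.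
nra.
Qed.
End euler.

(** * The limit curve of the scheme *)

Section flow.
Context {R : realType} {H : hilbertType R} (L : H * H -> R).
Hypothesis asdL : ASD L.
Implicit Types (x y z w p q : H) (l h t a b : R) (n k : nat).
Local Notation G := (flow_graph L).
Local Notation P := (yosida L).
Local Notation J := (resolvent L).
Local Notation step := (@step R).
Local Notation euler := (euler L).

(** A discrete form of Benilan's integral inequality. A step with slope [c] ending at [u] raises the
    squared distance to [z] by at most [2 h inner c (u - z)]; monotonicity replaces [c] by [q], and
    [euler_dist] bounds the drift of [u] from [x]. *)
Lemma euler_sqdist h k x p z q : 0 < h -> G (x, p) -> G (z, q) ->
  inner (euler h k x - z) (euler h k x - z) - inner (x - z) (x - z) <=
  2 * (k%:R * h) * (inner q (x - z) + k%:R * h * (`|q| * `|p|)).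
Proof.
move=> h0 Gx Gz; elim: k => [|k IH].
  by rewrite subrr mul0r mulr0 mul0r.
have := euler_dist asdL k.+1 h0 Gx.
have := flow_graph_monotone asdL (eulerS_graph asdL k x h0) Gz.
set c := P h (euler h k x) => m1 d1.
have := inner_ge0 (h *: c).
have E : euler h k x - z = (euler h k.+1 x - z) - h *: c.
  by rewrite eulerS -/c addrAC addrK.
move: IH; rewrite E.
set e := euler h k.+1 x - z in m1 *.
have e1 : inner q e <= inner q (x - z) + k.+1%:R * h * (`|q| * `|p|).
  rewrite (_ : e = (x - z) + (euler h k.+1 x - x)); last first.
    by rewrite addrC addrA subrK.
  rewrite innerDr lerD2l; apply: le_trans (inner_le _ _) _.
  by rewrite mulrCA ler_wpM2l.
move: e m1 e1 => e m1 e1; move: m1; rewrite !innerLR (innerC e c) => m1 IH c0.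
have {m1} m1 : h * inner c e <= h * inner q e by rewrite ler_pM2l//; lra.
have {e1} e1 := ler_wpM2l (ltW h0) e1.
have k1 : k.+1%:R = k%:R + 1 :> R by rewrite natr1.
have b0 : 0 <= k%:R * h * h * (`|q| * `|p|).
  by rewrite !mulr_ge0 ?(ltW h0).
rewrite k1 in e1 *; move: (k%:R : R) b0 e1 IH => K b0 e1 IH.
nra.
Qed.

(** The step counts are left free so that one passage to the limit serves both the start at time 0
    and a restart at a later time. *)
Lemma euler_limit (k : nat -> nat) t x y p : G (x, p) ->
  (k n)%:R * step n @[n --> \oo] --> t ->
  euler (step n) (k n) x @[n --> \oo] --> y ->
  [/\ forall l, 0 < l -> `|P l y| <= `|p|, `|y - x| <= t * `|p| &
    forall z q, G (z, q) ->
      inner (y - z) (y - z) - inner (x - z) (x - z) <=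
      2 * t * (inner q (x - z) + t * (`|q| * `|p|))].
Proof.
move=> Gx kt ky; split.
- move=> l l0; apply/ler_addgt0Pl => e e0.
  have d0 : 0 < e * l / 2 by rewrite !(divr_gt0, mulr_gt0).
  have /cvgrPdist_le/(_ _ d0) [N _ /(_ N (leqnn N)) Nd] := ky.
  rewrite -(subrK (P l (euler (step N) (k N) x)) (P l y)).
  apply: le_trans (ler_normD _ _) _; apply: lerD; last first.
    by apply: yosida_euler_le => //; exact: step_gt0.
  apply: le_trans (yosida_lipschitz asdL _ _ l0) _.
  apply: (le_trans (ler_wpM2l _ Nd)); first by rewrite divr_ge0// ltW.
  by rewrite le_eqVlt; apply/orP; left; apply/eqP; field; rewrite lt0r_neq0.
- have cn : `|euler (step n) (k n) x - x| @[n --> \oo] --> `|y - x|.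
    by apply: cvg_norm; apply: cvgB => //; exact: cvg_cst.
  have ct : (k n)%:R * step n * `|p| @[n --> \oo] --> t * `|p|.
    by apply: cvgM => //; exact: cvg_cst.
  apply: ler_cvg_to cn ct _; apply: nearW => n.
  by apply: euler_dist => //; exact: step_gt0.
- move=> z q Gz.
  have cl : inner (euler (step n) (k n) x - z) (euler (step n) (k n) x - z) -
      inner (x - z) (x - z) @[n --> \oo] -->
      inner (y - z) (y - z) - inner (x - z) (x - z).
    by apply: cvgB; [apply: cvg_inner; apply: cvgB => //|]; exact: cvg_cst.
  have cr : 2 * ((k n)%:R * step n) *
      (inner q (x - z) + (k n)%:R * step n * (`|q| * `|p|)) @[n --> \oo] -->
      2 * t * (inner q (x - z) + t * (`|q| * `|p|)).
    apply: cvgM; first by apply: cvgM => //; exact: cvg_cst.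
    apply: cvgD; first exact: cvg_cst.
    by apply: cvgM => //; exact: cvg_cst.
  apply: ler_cvg_to cl cr _; apply: nearW => n.
  by apply: euler_sqdist => //; exact: step_gt0.
Qed.

Definition nsteps t n : nat := Num.truncn (t / step n).

Lemma nsteps_le t n : 0 <= t -> (nsteps t n)%:R * step n <= t.
Proof.
by move=> t0; rewrite -ler_pdivlMr ?step_gt0// truncn_le divr_ge0// ltW// step_gt0.
Qed.

Lemma nsteps_gt t n : t - step n < (nsteps t n)%:R * step n.
Proof.
have := truncnS_gt (t / step n); rewrite -/(nsteps t n) -natr1.
by rewrite ltr_pdivrMr ?step_gt0// mulrDl mul1r ltrBlDr.
Qed.

Lemma cvg_nsteps t : 0 <= t -> (nsteps t n)%:R * step n @[n --> \oo] --> t.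
Proof.
move=> t0; apply: (@squeeze_cvgr _ _ _ _ (fun n => t - step n) (cst t)).
- by apply: nearW => n; rewrite nsteps_le// ltW// nsteps_gt.
- by rewrite -[X in _ --> X]subr0; apply: cvgB; [exact: cvg_cst|exact: cvg_step].
- exact: cvg_cst.
Qed.

Lemma nsteps_mono a b n : a <= b -> (nsteps a n <= nsteps b n)%N.
Proof. by move=> ab; apply: le_truncn; rewrite ler_pM2r// invr_gt0 step_gt0. Qed.

Lemma nstepsS t n : 0 <= t ->
  exists2 r, nsteps t n.+1 = (r + 4 * nsteps t n)%N & (r <= 3)%N.
Proof.
move=> t0; have s0 := step_gt0 n : 0 < step n.
have E : t / step n.+1 = 4 * (t / step n).
  by rewrite /step exprS; field; rewrite lt0r_neq0.
have d0 : 0 <= t / step n by rewrite divr_ge0// ltW.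
have d40 : 0 <= 4 * (t / step n) by rewrite mulr_ge0.
have := truncn_itv d0; rewrite -/(nsteps t n) => /andP[h1 h2].
exists (nsteps t n.+1 - 4 * nsteps t n)%N.
  rewrite subnK// /nsteps E truncn_ge_nat// natrM ler_wpM2l//.
rewrite leq_subLR addnC -ltnS /nsteps E truncn_lt_nat// -/(nsteps t n).
rewrite -addSn addnC natrD natrM; move: h2; rewrite -natr1; lra.
Qed.

Lemma euler_cvg t x p : 0 <= t -> G (x, p) ->
  cvgn (fun n => euler (step n) (nsteps t n) x).
Proof.
(* The first term is the refinement error, with [t + 1] meeting the condition [1 <= t] of
   [euler_quarter]; [3 * |p|] pays for the at most three leftover steps, the next base-4 digit of
   [t]. *)
move=> t0 Gx; apply: (@cvgn_geometric _ _ _ (2 * (t + 1) * `|p| + 3 * `|p|)) => n.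
have [r -> r3] := nstepsS n t0; rewrite eulerD.
rewrite -(subrKA (euler (step n.+1) (4 * nsteps t n) x)).
apply: le_trans (ler_normD _ _) _; rewrite addrC [leRHS]mulrDl; apply: lerD.
  rewrite distrC; apply: euler_quarter => //; first by rewrite lerDr.
  by apply: le_trans (nsteps_le n t0) _; rewrite lerDl.
have [q Gq qp] := euler_graph asdL (4 * nsteps t n) (step_gt0 n.+1) Gx.
apply: le_trans (euler_dist asdL r (step_gt0 n.+1) Gq) _.
rewrite mulrAC; apply: ler_pM; rewrite ?mulr_ge0 ?(ltW (step_gt0 _))//.
  by apply: ler_pM => //; rewrite ler_nat.
rewrite /step exprS (_ : 4^-1 ^+ n = 2^-1 ^+ n * 2^-1 ^+ n); last first.
  by rewrite -exprMn; congr (_ ^+ _); field.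
have : 0 <= 2^-1 ^+ n :> R by rewrite exprn_ge0.
have : 2^-1 ^+ n <= 1 :> R by rewrite exprn_ile1// invf_le1//; lra.
nra.
Qed.

Definition flow x t : H := limn (fun n => euler (step n) (nsteps t n) x).

Lemma cvg_flow t x p : 0 <= t -> G (x, p) ->
  euler (step n) (nsteps t n) x @[n --> \oo] --> flow x t.
Proof. by move=> t0 Gx; exact: (euler_cvg t0 Gx). Qed.

Lemma flow0 x : flow x 0 = x.
Proof.
rewrite /flow (_ : (fun n => _) = cst x); first exact: lim_cst.
by apply/funext => n; rewrite /nsteps mul0r truncn0.
Qed.

(** Truncated step counts are not additive, so the restart takes the difference of the counts at [b]
    and [a]. Nonexpansiveness absorbs the replacement of the Euler point at [a] by its limit. *)
Lemma cvg_flow_restart a b x p : 0 <= a -> a <= b -> G (x, p) ->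
  euler (step n) (nsteps b n - nsteps a n)%N (flow x a) @[n --> \oo] -->
  flow x b.
Proof.
move=> a0 ab Gx; have ca := cvg_flow a0 Gx.
have cb := cvg_flow (le_trans a0 ab) Gx.
have dl : euler (step n) (nsteps b n) x -
    euler (step n) (nsteps b n - nsteps a n)%N (flow x a) @[n --> \oo] --> (0 : H).
  apply/cvgr0Pnorm_le => e e0; have /cvgrPdist_le/(_ _ e0) near_a := ca.
  near=> n; apply: (@le_trans _ _ `|flow x a - euler (step n) (nsteps a n) x|).
    rewrite -{1}(subnK (nsteps_mono n ab)) eulerD distrC.
    by apply: euler_le; rewrite ?step_gt0.
  by near: n; exact: near_a.
have : euler (step n) (nsteps b n) x - (euler (step n) (nsteps b n) x -
    euler (step n) (nsteps b n - nsteps a n)%N (flow x a)) @[n --> \oo] -->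
    flow x b - 0.
  by apply: cvgB.
by rewrite subr0; under eq_cvg do rewrite opprB addrC subrK.
Unshelve. all: by end_near. Qed.

Lemma cvg_nsteps_sub a b : 0 <= a -> a <= b ->
  (nsteps b n - nsteps a n)%:R * step n @[n --> \oo] --> b - a.
Proof.
move=> a0 ab; under eq_cvg => n.
  rewrite natrB ?nsteps_mono// mulrBl; over.
by apply: cvgB; apply: cvg_nsteps => //; exact: le_trans ab.
Qed.

End flow.

(** * Differentiability off a countable set *)

Lemma is_derive_epsP (R : realType) (V : normedModType R) (f : R -> V) (s : R)
    (d : V) :
  is_derive s 1 f d <->
  (forall e, 0 < e -> exists2 r, 0 < r & forall h, h != 0 -> `|h| < r ->
    `|d - h^-1 *: (f (h + s) - f s)| <= e).
Proof.
split.
- move=> [df <-] e e0; have /cvgrPdist_le/(_ _ e0) := df.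
  move=> /nbhs_ballP[r /= r0 rP]; exists r => // h h0 hr.
  have := rP h; rewrite /= -ball_normE/= sub0r normrN => /(_ hr h0).
  by rewrite scaler1.
- move=> fP.
  have cd : h^-1 *: (f (h *: (1 : R) + s) - f s) @[h --> 0^'] --> d.
    apply/cvgrPdist_le => e /fP[r r0 rP].
    apply/nbhs_ballP; exists r => //= h; rewrite -ball_normE/= sub0r normrN.
    by move=> hr h0; rewrite scaler1; exact: rP.
  apply: DeriveDef; first by apply/cvg_ex; exists d.
  exact: cvg_lim cd.
Qed.

(** Each jump interval contains a rational, and by monotonicity the jumps at different points are
    disjoint. *)
Lemma countable_left_discontinuity (R : realType) (f : R -> R) (D : set R) :
  {in D &, {homo f : a b / a <= b >-> b <= a}} ->
  countable [set s | D s /\ exists2 e, 0 < e &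
    forall a, D a -> a < s -> f s + e < f a].
Proof.
move=> ndf; set C := [set s | _].
have qP (s : R) : exists q : rat, C s ->
    f s < ratr q /\ forall a, D a -> a < s -> ratr q < f a.
  have [[Ds [e e0 ef]]|nC] := pselect (C s); last by exists 0.
  have [q /itvP qse] := @rat_in_itvoo R (f s) (f s + e) (ltac:(by rewrite ltrDl)).
  exists q => _; split => [|a Da las]; first by rewrite qse.
  by apply: lt_trans (ef a Da las); rewrite qse.
have [q qC] := choice qP.
have injq : {in C &, injective q}.
  move=> s t /set_mem Cs /set_mem Ct qst.
  have lt (u v : R) : C u -> C v -> u < v -> q u = q v -> False.
    move=> Cu Cv uv quv; have [_ /(_ u (proj1 Cu) uv)] := qC v Cv.
    by have [+ _] := qC u Cu; rewrite quv => /lt_trans /[apply]; rewrite ltxx.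
  have [st|ts|//] := ltgtP s t; first by case: (lt s t).
  by case: (lt t s).
apply/countable_injP; exists (pickle \o q) => s t sC tC /= /(pcan_inj pickleK); exact: injq.
Qed.

Section evolution.
Context {R : realType} {H : hilbertType R} (L : H * H -> R).
Hypothesis asdL : ASD L.
Implicit Types (x y z w p q : H) (l h t a b : R) (n k : nat).
Local Notation G := (flow_graph L).
Local Notation P := (yosida L).
Local Notation J := (resolvent L).
Local Notation step := (@step R).

(** Taking [d t] as a limit of Yosida values makes its norm nonincreasing: a restart at [a] bounds
    every [|P l (y b)|] by [|d a|], and this passes to the limit [d b]. *)
Lemma evolution_exists x0 p0 : G (x0, p0) -> exists (y d : R -> H),
  [/\ y 0 = x0,
    forall t, 0 <= t -> G (y t, d t) /\ `|d t| <= `|p0|,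
    forall t, 0 <= t -> P (step n) (y t) @[n --> \oo] --> d t &
    forall a b, 0 <= a -> a <= b ->
    [/\ `|d b| <= `|d a|, `|y b - y a| <= (b - a) * `|d a| &
     forall z q, G (z, q) ->
      inner (y b - z) (y b - z) - inner (y a - z) (y a - z) <=
      2 * (b - a) * (inner q (y a - z) + (b - a) * (`|q| * `|d a|))]].
Proof.
move=> G0; pose y := flow L x0.
have dP t : exists q, 0 <= t -> [/\ G (y t, q), `|q| <= `|p0| &
    P (step n) (y t) @[n --> \oo] --> q].
  have [t0|t0] := leP 0 t; last by exists 0.
  have [Py _ _] := euler_limit asdL G0 (cvg_nsteps t0) (cvg_flow asdL t0 G0).
  by have [q qP] := cvg_yosida asdL Py; exists q.
have [d {}dP] := choice dP; exists y, d; split.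
- exact: flow0.
- by move=> t /dP[].
- by move=> t /dP[].
move=> a b a0 ab; have [Ga _ _] := dP a a0.
have [_ _ cb] := dP b (le_trans a0 ab).
have [Pb yab ine] := euler_limit asdL Ga (cvg_nsteps_sub a0 ab)
  (cvg_flow_restart asdL a0 ab G0).
split => //; rewrite -(cvg_lim _ (cvg_norm cb))//.
apply: limr_le; first by apply: cvgP (cvg_norm cb).
by apply: nearW => n; apply: Pb; exact: step_gt0.
Qed.

(* With [q = P l (y s)] and [z = J l (y s)], [y s - z = - l q], so the integral
   inequality bounds [inner w q] below for every difference quotient [w] of [y]
   near [s]. *)
Lemma quotient_close y0 x1 x2 l h (N : R) : 0 < l -> 0 < h ->
  let w := h^-1 *: (x2 - x1) in let q := P l y0 in
  `|w| <= N -> `|q| <= N -> `|x1 - y0| <= h * N ->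
  (forall z q, G (z, q) -> inner (x2 - z) (x2 - z) - inner (x1 - z) (x1 - z) <=
      2 * h * (inner q (x1 - z) + h * (`|q| * N))) ->
  inner (w - q) (w - q) <= inner w w - inner q q + 6 * N ^+ 2 * h / l.
Proof.
move=> l0 h0 w q wN qN x1N ine.
have := ine _ _ (resolvent_graph asdL y0 l0); rewrite -/q /resolvent -/q.
have -> : x2 = x1 + h *: w by rewrite /w scalerA divff ?gt_eqF// scale1r addrC subrK.
move: w q wN qN => w q wN qN {ine}.
set e := x1 - y0 in x1N *.
have -> : x1 - (y0 + l *: q) = e - l *: q by rewrite opprD addrA.
have -> : x1 + h *: w - (y0 + l *: q) = e - l *: q + h *: w.
  by rewrite addrAC /e opprD addrA.
move: e x1N => e eN.
have N0 : 0 <= N by exact: le_trans wN.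
(* The three errors [- inner e w], [inner e q] and [h |q| N] are each at most [h N^2]; expanding
   [|w - q|^2] doubles their sum, hence the constant 6. *)
have bound v : `|v| <= N -> `|inner e v| <= h * N ^+ 2.
  move=> vN; apply: le_trans (inner_norm_le _ _) _.
  by rewrite expr2 mulrA ler_pM.
have /ler_normlP[ew _] := bound _ wN; have /ler_normlP[_ eq] := bound _ qN.
have qN2 : h * (`|q| * N) <= h * N ^+ 2.
  by rewrite ler_pM2l// expr2 ler_wpM2r.
have hw : 0 <= inner (h *: w) (h *: w) := inner_ge0 _.
move: hw ew eq; rewrite !innerLR (innerC w e) (innerC q e) (innerC w q).
move: (inner e w) (inner e q) (inner q w) (inner w w) (inner q q) (inner e e).
move=> iew ieq iqw iww iqq iee hw ew eq ine.
have {ine} : h * (2 * (iew - l * iqw)) <=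
    h * (2 * (ieq - l * iqq + h * N ^+ 2)) by nra.
rewrite ler_pM2l// => ine.
rewrite -lerBlDl ler_pdivlMr//; lra.
Qed.

(** Quotients to the right of [s] are bounded by [|d s|] outright. Those to the left start at some
    [b < s] and need a point [a <= b] with [|d a|] close to [|d s|], so [C] collects the left jumps
    only. *)
Lemma evolution x0 p0 : G (x0, p0) -> exists (y d : R -> H) (C : set R),
  [/\ countable C,
    [/\ forall t, t <= 0 -> y t = x0, forall t, G (y t, d t),
        forall t, `|d t| <= `|p0| &
        forall a b, `|y b - y a| <= `|p0| * `|b - a|] &
    forall t, 0 < t -> ~ C t -> is_derive t 1 y (d t)].
Proof.
move=> G0; have [y [d [y0 yd yosd yab]]] := evolution_exists G0.
set N := `|p0|; have N0 : 0 <= N := normr_ge0 _.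
pose D := [set t : R | 0 <= t].
pose C := [set s | D s /\ exists2 e, 0 < e &
    forall a, D a -> a < s -> inner (d s) (d s) + e < inner (d a) (d a)].
have m0 t : 0 <= Num.max 0 t by rewrite le_max lexx.
exists (fun t => y (Num.max 0 t)), (fun t => d (Num.max 0 t)), C; split.
- apply: (@countable_left_discontinuity _ (fun s => inner (d s) (d s))).
  move=> a b /set_mem a0 _ ab; have [dba _ _] := yab a b a0 ab.
  by rewrite !innerE lerXn2r ?nnegrE.
- split.
  + by move=> t t0; rewrite max_l.
  + by move=> t; have [] := yd _ (m0 t).
  + by move=> t; have [] := yd _ (m0 t).
  + suff W a b : a <= b -> `|y (Num.max 0 b) - y (Num.max 0 a)| <= N * `|b - a|.
      move=> a b; have /orP[ab|ba] := le_total a b; first exact: W.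
      by rewrite distrC (distrC b); exact: W.
    move=> ab; have mab : Num.max 0 a <= Num.max 0 b.
      by rewrite ge_max !le_max lexx/= ab orbT.
    have [_ yN _] := yab _ _ (m0 a) mab; apply: le_trans yN _.
    have [_ dN] := yd _ (m0 a).
    rewrite mulrC ler_pM// ?subr_ge0//.
    rewrite ger0_norm ?subr_ge0//.
    have [a0|a0] := leP a 0; have [b0|b0] := leP b 0; lra.
move=> s s0 nCs; apply/is_derive_epsP => e e0.
have [Gs dsN] := yd s (ltW s0); have cs := yosd s (ltW s0).
rewrite !max_r ?(ltW s0)//.
(* Errors of [e ^+ 2 / 12] arise from [d a] against [d s], from [d s] against the Yosida value, and
   from [quotient_close]; together they make [(e / 2)^2]. The other [e / 2] is the distance from
   [d s] to the Yosida value. *)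
have [a [a0 as_ da]] : exists a, [/\ 0 <= a, a < s &
    inner (d a) (d a) <= inner (d s) (d s) + e ^+ 2 / 12].
  apply: contrapT => na; apply: nCs; split; first by rewrite /D/= ltW.
  exists (e ^+ 2 / 12); first by rewrite divr_gt0// exprn_gt0.
  move=> a a0 as_; rewrite ltNge; apply/negP => le; apply: na.
  by exists a.
have [n [n1 n2]] : exists n, `|d s - P (step n) (y s)| <= e / 2 /\
    inner (d s) (d s) <= inner (P (step n) (y s)) (P (step n) (y s)) + e ^+ 2 / 12.
  have e20 : 0 < e / 2 by rewrite divr_gt0.
  have e120 : 0 < e ^+ 2 / 12 by rewrite divr_gt0// exprn_gt0.
  have /cvgrPdist_le/(_ _ e20) c1 := cs.
  have /cvgrPdist_le/(_ _ e120) c2 := cvg_inner cs cs.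
  have [n [h1 h2]] := filter_ex (filterI c1 c2); exists n; split=> //.
  by move: h2 => /ler_normlP[_]; lra.
pose l := step n; have l0 : 0 < l := step_gt0 n.
pose r := Num.min (s - a) (e ^+ 2 / 12 * l / (6 * N ^+ 2 + 1)).
have c0 : 0 < 6 * N ^+ 2 + 1 by rewrite ltr_wpDl// mulr_ge0// sqr_ge0.
exists r.
  rewrite lt_min subr_gt0 as_/= divr_gt0// mulr_gt0// divr_gt0// exprn_gt0//.
have hr_le h : h < r -> 0 < h -> 6 * N ^+ 2 * h / l <= e ^+ 2 / 12.
  rewrite lt_min => /andP[_]; rewrite ltr_pdivlMr// => hr h0.
  by rewrite ler_pdivrMr//; lra.
have key b c h : a <= b -> 0 < h -> c = b + h -> `|y b - y s| <= h * N ->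
    h < r -> `|d s - h^-1 *: (y c - y b)| <= e.
  move=> ab h0 -> ybs hr; have b0 := le_trans a0 ab.
  have [_] := yab b (b + h) b0 (ltac:(by rewrite lerDl ltW)).
  rewrite addrAC subrr add0r => ych ine.
  have [dba _ _] := yab a b a0 ab; have [_ dbN] := yd b b0.
  have wdb : `|h^-1 *: (y (b + h) - y b)| <= `|d b|.
    by rewrite normrZ gtr0_norm ?invr_gt0// mulrC ler_pdivrMr// mulrC.
  have qd : `|P l (y s)| <= `|d s| := yosida_le asdL l0 Gs.
  have ine' z q : G (z, q) -> inner (y (b + h) - z) (y (b + h) - z) -
      inner (y b - z) (y b - z) <= 2 * h * (inner q (y b - z) + h * (`|q| * N)).
    move=> /ine/le_trans; apply; rewrite ler_pM2l ?mulr_gt0// lerD2l.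
    by rewrite ler_pM2l// ler_wpM2l.
  have := quotient_close l0 h0 (le_trans wdb dbN) (le_trans qd dsN) ybs ine'.
  have := hr_le h hr h0.
  move: (h^-1 *: _) wdb (P l (y s)) qd n1 n2 => w wdb q qd n1 n2 h1 h2.
  have wd : inner w w <= inner (d a) (d a).
    by rewrite !innerE lerXn2r ?nnegrE// (le_trans wdb).
  rewrite -(subrK q (d s)) -addrA [leRHS]splitr.
  apply: le_trans (ler_normD _ _) _; apply: lerD => //.
  rewrite distrC; apply: ler_sqr_norm; first by rewrite ltW// divr_gt0.
  move: (6 * N ^+ 2 * h / l) h1 h2 => X h1 h2.
  rewrite expr_div_n (_ : 2 ^+ 2 = 4 :> R); last by ring.
  lra.
move=> h; have [h0|h0|//] := ltgtP h 0 => _ hr.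
  have hs : a <= h + s.
    move: hr; rewrite ltr0_norm// lt_min => /andP[+ _]; lra.
  have hs0 := le_trans a0 hs.
  rewrite max_r// -(opprK (y (h + s) - y s)) opprB scalerN -scaleNr -invrN.
  apply: (key (h + s) s) => //; rewrite ?oppr_gt0//.
  - by rewrite addrAC subrr add0r.
  - have [_ + _] := yab (h + s) s hs0 (ltac:(by rewrite gerDr ltW)).
    rewrite distrC => /le_trans; apply; rewrite ler_pM//; [lra|lra|].
    by have [] := yd _ hs0.
  - by rewrite -ltr0_norm.
rewrite (max_r (addr_ge0 (ltW h0) (ltW s0))); apply: (key s (h + s)) => //.
- exact: ltW.
- by rewrite addrC.
- by rewrite subrr normr0 mulr_ge0// ltW.
- by rewrite -(gtr0_norm h0).
Qed.
End evolution.

(** * Strong measurability and Lipschitz curves *)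

Section strong_measurability_theory.
Context {R : realType} d (X : measurableType d) (V : normedModType R).
Implicit Types (D B : set X) (f g : X -> V).

Lemma simple_indic B g : measurable B -> simple g ->
  simple (fun x => \1_B x *: g x).
Proof.
move=> mB [n [A [v [mA ->]]]]; exists n, (fun i => B `&` A i), v; split.
  by move=> i; exact: measurableI.
apply/funext => x; rewrite scaler_sumr; apply: eq_bigr => i _.
by rewrite scalerA indicI.
Qed.

Lemma strongly_measurable_indic D B f : measurable B ->
  strongly_measurable D f -> strongly_measurable D (fun x => \1_B x *: f x).
Proof.
move=> mB [g sg gf]; exists (fun n x => \1_B x *: g n x).
  by move=> n; exact: simple_indic.
by move=> x Dx; apply: cvgZ; [exact: cvg_cst|exact: gf].
Qed.

Lemma strongly_measurable_eq D f g : (forall x, D x -> f x = g x) ->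
  strongly_measurable D f -> strongly_measurable D g.
Proof.
by move=> fg [h sh hf]; exists h => // x Dx; rewrite -fg//; exact: hf.
Qed.

Lemma strongly_measurable_comp d' (Y : measurableType d') (phi : Y -> X)
    (D' : set Y) D f : measurable_fun setT phi -> (forall y, D' y -> D (phi y)) ->
  strongly_measurable D f -> strongly_measurable D' (f \o phi).
Proof.
move=> mphi DD [g sg gf]; exists (fun n => g n \o phi); last first.
  by move=> y /DD; exact: gf.
move=> n; have [m [A [v [mA ->]]]] := sg n.
exists m, (fun i => phi @^-1` A i), v; split=> // i.
by rewrite -[X in measurable X]setTI; exact: mphi.
Qed.

End strong_measurability_theory.

Section lipschitz_curves.
Context {R : realType} {V : normedModType R}.
Implicit Types (f : R -> V) (a K : R) (C : set R).

Definition lipschitz_with K f := forall s t, `|f t - f s| <= K * `|t - s|.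

Lemma lipschitz_with_ge0 K f : lipschitz_with K f -> 0 <= K.
Proof. by move=> /(_ 0 1); rewrite subr0 normr1 mulr1; exact: le_trans. Qed.

Lemma lipschitz_quotient (h : R) K f : 0 < h -> lipschitz_with K f ->
  lipschitz_with (h^-1 * (K + K)) (fun t => h^-1 *: (f (h + t) - f t)).
Proof.
move=> h0 fK s t; rewrite -scalerBr normrZ gtr0_norm ?invr_gt0// -mulrA.
rewrite ler_pM2l ?invr_gt0// opprD addrACA -opprD mulrDl.
apply: le_trans (ler_normB _ _) _; apply: lerD; last exact: fK.
by apply: le_trans (fK _ _) _; rewrite opprD addrACA subrr add0r.
Qed.

Lemma lipschitz_simple a K f e : lipschitz_with K f -> 0 < e ->
  exists2 g, simple g & forall t, t \in `[0, a] -> `|f t - g t| <= e.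
Proof.
move=> fK e0; have K0 := lipschitz_with_ge0 fK.
pose dl := e / (K + 1).
have dl0 : 0 < dl by rewrite divr_gt0// ltr_wpDl.
pose m := (Num.truncn (a / dl)).+1.
exists (fun t => \sum_(i < m) \1_(`[i%:R * dl, i.+1%:R * dl[%classic) t *: f (i%:R * dl)).
  exists m, (fun i : 'I_m => `[i%:R * dl, i.+1%:R * dl[%classic),
    (fun i => f (i%:R * dl)); split => // i; exact: measurable_itv.
move=> t /[!in_itv]/= /andP[t0 ta].
have td0 : 0 <= t / dl by rewrite divr_ge0// ltW.
have im : (Num.truncn (t / dl) < m)%N.
  by rewrite ltnS; apply: le_truncn; rewrite ler_pM2r// invr_gt0.
have /andP[h1 h2] := truncn_itv td0.
rewrite ler_pdivlMr// in h1; rewrite ltr_pdivrMr// in h2.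
rewrite (bigD1 (Ordinal im))//= big1 ?addr0; last first.
  move=> i ii; rewrite indicE memNset ?scale0r// /= in_itv/= => /andP[].
  rewrite -ler_pdivlMr// -ltr_pdivrMr// => i1 i2; move/eqP: ii; apply.
  by apply: val_inj => /=; apply/esym/truncn_def; rewrite i1 i2.
rewrite indicE mem_set ?scale1r; last by rewrite /= in_itv/= h1 h2.
apply: le_trans (fK _ _) _; rewrite ger0_norm ?subr_ge0//.
have : t - (Num.truncn (t / dl))%:R * dl <= dl.
  by move: h2; rewrite -natr1 mulrDl mul1r; lra.
move=> /(ler_wpM2l K0)/le_trans; apply.
by rewrite /dl mulrCA ler_piMr ?(ltW e0)// ler_pdivrMr ?ltr_wpDl// mul1r lerDl.
Qed.

Lemma strongly_measurable_lipschitz a K f : lipschitz_with K f ->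
  strongly_measurable `[0, a] f.
Proof.
move=> fK.
have gP n : exists g, simple g /\
    forall t, t \in `[0, a] -> `|f t - g t| <= n.+1%:R^-1.
  have [|g sg fg] := @lipschitz_simple a K f n.+1%:R^-1 fK; last by exists g.
  by rewrite invr_gt0.
have [g {}gP] := choice gP; exists g => [n|t ta]; first by have [] := gP n.
apply/cvgrPdist_le => e e0.
have /cvgr0Pnorm_le/(_ _ e0) := @cvg_harmonic R.
apply: filterS => n /(le_trans (ler_norm _)); apply: le_trans.
by have [_] := gP n; apply.
Qed.

(** Forward quotients of a Lipschitz curve are Lipschitz, hence uniformly close to simple functions.
    Cutting off on [C] makes the approximation converge at every point. *)
Lemma strongly_measurable_derivative a K f C (df : R -> V) :
  lipschitz_with K f -> countable C ->
  (forall t, t \in `[0, a] -> ~ C t -> is_derive t 1 f (df t)) ->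
  strongly_measurable `[0, a] (fun t => \1_(~` C) t *: df t).
Proof.
move=> fK cC fdf; have mC : measurable (~` C).
  by apply: measurableC; exact: countable_measurable.
have K0 := lipschitz_with_ge0 fK.
pose h n : R := n.+1%:R^-1; have h0 n : 0 < h n by rewrite invr_gt0.
pose q n t := (h n)^-1 *: (f (h n + t) - f t).
have qK n := lipschitz_quotient (h0 n) fK.
have gP n : exists g, simple g /\
    forall t, t \in `[0, a] -> `|q n t - g t| <= h n.
  by have [|g sg fg] := @lipschitz_simple a _ (q n) (h n) (qK n); last by exists g.
have [g {}gP] := choice gP.
exists (fun n t => \1_(~` C) t *: g n t) => [n|t ta].
  by apply: simple_indic => //; have [] := gP n.
have [Ct|nCt] := pselect (C t).
  rewrite indicE memNset ?scale0r; last by move=> /(_ Ct).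
  under eq_cvg do rewrite scale0r; exact: cvg_cst.
apply: cvgZ; first exact: cvg_cst.
have /is_derive_epsP dP := fdf t ta nCt.
apply/cvgrPdist_le => e e0; have e20 : 0 < e / 2 by rewrite divr_gt0.
have [r r0 rP] := dP _ e20.
have /cvgr0Pnorm_le/(_ _ e20) c1 := @cvg_harmonic R.
have /cvgr0Pnorm_lt/(_ _ r0) c2 := @cvg_harmonic R.
near=> n; rewrite -(subrKA (q n t)) [leRHS]splitr.
apply: le_trans (ler_normD _ _) _; apply: lerD.
  apply: rP; first by rewrite gt_eqF.
  by near: n; exact: c2.
have [_ /(_ t ta)/le_trans] := gP n; apply; apply: le_trans (ler_norm _) _.
by near: n; exact: c1.
Unshelve. all: by end_near. Qed.

End lipschitz_curves.

(** * Square-integrable classes and [A2] *)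

Section square_integrable.
Context {R : realType} {V : normedModType R} (a : R).
Local Notation leb := (@lebesgue_measure R).
Implicit Types (f g : R -> V).

(** A small bound [r] everywhere plus a large [M] on a short interval is the shape of the difference
    quotient error of [curve], which is large only near the diagonal. *)
Lemma Lnorm_norm_on_le f (M r b c : R) : 0 <= a -> 0 <= r -> 0 <= M -> b <= c ->
  strongly_measurable `[0, a] f ->
  (forall t, t \in `[0, a] -> `|f t| ^+ 2 <= r + M * \1_(`[b, c]%classic) t) ->
  ('N[leb]_2%:E[EFin \o norm_on a f] `^ 2 <= (r * a + M * (c - b))%:E)%E.
Proof.
move=> a0 r0 M0 bc mf fle.
rewrite Lnorm2E -poweRrM mulVf// poweRe1; last first.
  by apply: integral_ge0 => t _; rewrite lee_fin powR_ge0.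
have mi (b' c' : R) : measurable_fun setT (\1_(`[b', c']%classic) : R -> R).
  by apply: measurable_indic; exact: measurable_itv.
have mM (k b' c' : R) :
    measurable_fun setT (fun t => (k * \1_(`[b', c']%classic) t)%:E).
  by apply/measurable_EFinP; apply: measurable_funM.
have int_indic (k b' c' : R) : 0 <= k -> b' <= c' ->
    (\int[leb]_t (k * \1_(`[b', c']%classic) t)%:E)%E = (k * (c' - b'))%:E.
  move=> k0 bc'; under eq_integral do rewrite EFinM.
  rewrite ge0_integralZl_EFin//.
  - rewrite integral_indic// setIT/= lebesgue_measure_itv/= lte_fin.
    by case: ltP => // cb; rewrite (@le_anti _ _ b' c') ?subrr ?mulr0 ?mule0 ?bc'.
  - by apply/measurable_EFinP; exact: mi.
apply: (@le_trans _ _ (\int[leb]_t ((r * \1_(`[0, a]%classic) t)%:E +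
    (M * \1_(`[b, c]%classic) t)%:E))%E).
  apply: ge0_le_integral => //.
  - by apply: measurable_powR2; exact: measurable_norm_on.
  - apply: emeasurable_funD; exact: mM.
  move=> t _; rewrite -EFinD lee_fin powR_mulrn// /norm_on patchE.
  have [ta|ta] := boolP (t \in (`[0, a]%classic : set R)).
    rewrite indicE ta mulr1 normr_id; apply: fle; move: ta; rewrite inE//.
  by rewrite normr0 expr0n/= addr_ge0// mulr_ge0.
rewrite ge0_integralD//; first by rewrite !int_indic// subr0 EFinD.
- by move=> t ?; rewrite lee_fin mulr_ge0.
- exact: mM.
- by move=> t ?; rewrite lee_fin mulr_ge0.
- exact: mM.
Qed.

Lemma L2fun_bounded f (M : R) : 0 <= a -> strongly_measurable `[0, a] f ->
  (forall t, t \in `[0, a] -> `|f t| <= M) -> L2fun a f.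
Proof.
move=> a0 mf fM; split => //; rewrite /finite_norm ltNge leye_eq; apply/eqP => N.
have M0 : 0 <= M by apply: le_trans (fM 0 _); rewrite ?in_itv/= ?lexx.
have := @Lnorm_norm_on_le f 0 (M ^+ 2) 0 0 a0 (sqr_ge0 _) (lexx _) (lexx _) mf.
rewrite N poweRyr ?pnatr_eq0// => /(_ _)/le_trans.
move=> H; have : (+oo <= (M ^+ 2 * a + 0 * (0 - 0))%:E :> \bar R)%E.
  apply: H => // t ta; rewrite mul0r addr0.
  by rewrite lerXn2r ?nnegrE ?fM.
by rewrite leye_eq.
Qed.

Local Open Scope quotient_scope.

(** Total, with value 0 off the square-integrable functions, so that [curve] carries no proof
    argument. *)
Definition toL2 f : L2 a V :=
  if pselect (L2fun a f) is left Lf then \pi_(L2 a V) (Sqint (mem_set Lf)) else 0.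

Lemma toL2E f (Lf : L2fun a f) :
  toL2 f = \pi_(L2 a V) (Sqint (mem_set Lf)).
Proof.
by rewrite /toL2; case: pselect => // h; congr (\pi_ _ _); exact: val_inj.
Qed.

Lemma represents_toL2 f : L2fun a f -> represents f (toL2 f).
Proof.
move=> Lf; rewrite /represents (toL2E Lf).
set F := Sqint (mem_set Lf).
have /L2_eqP : F = repr (\pi_(L2 a V) F) %[mod L2 a V] by rewrite reprK.
rewrite inE/=; apply: (@filterS _ _ (ae_filter_ringOfSetsType leb)) => t + ta.
by move=> /(_ ta)/eqP; rewrite subr_eq0 => /eqP.
Qed.

Lemma L2funB f g : L2fun a f -> L2fun a g -> L2fun a (f - g).
Proof.
move=> Lf Lg; have : f - g \in @L2pred R V a by rewrite rpredB// inE.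
by rewrite inE.
Qed.

Lemma L2funZ (k : R) f : L2fun a f -> L2fun a (k *: f).
Proof.
move=> Lf; have : k *: f \in @L2pred R V a by rewrite rpredZ// inE.
by rewrite inE.
Qed.

Lemma toL2B f g : L2fun a f -> L2fun a g -> toL2 (f - g) = toL2 f - toL2 g.
Proof.
move=> Lf Lg; rewrite (toL2E Lf) (toL2E Lg) (toL2E (L2funB Lf Lg)) -raddfB.
by congr (\pi_ _ _); exact: val_inj.
Qed.

Lemma toL2Z (k : R) f : L2fun a f -> toL2 (k *: f) = k *: toL2 f.
Proof.
move=> Lf; rewrite (toL2E Lf) (toL2E (L2funZ k Lf)) [RHS]L2_scale_pi.
by congr (\pi_ _ _); exact: val_inj.
Qed.

Lemma norm_toL2_le f (M r b c : R) : 0 <= a -> 0 <= r -> 0 <= M -> b <= c ->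
  L2fun a f ->
  (forall t, t \in `[0, a] -> `|f t| ^+ 2 <= r + M * \1_(`[b, c]%classic) t) ->
  `|toL2 f| ^+ 2 <= r * a + M * (c - b).
Proof.
move=> a0 r0 M0 bc Lf /(Lnorm_norm_on_le a0 r0 M0 bc (proj1 Lf)).
rewrite (toL2E Lf) [`| _ |]L2_norm_pi /sqint_norm/=.
rewrite -(fineK (Lnorm_norm_on_fin Lf)) poweR_EFin lee_fin powR_mulrn//.
by rewrite fine_ge0// Lnorm_ge0.
Qed.

End square_integrable.

Section lipschitz_A2.
Context {R : realType} {V : normedModType R}.
Implicit Types (f : R -> V) (a K : R) (C : set R).

Lemma derivative_bound K f (t : R) (v : V) : lipschitz_with K f -> is_derive t 1 f v ->
  `|v| <= K.
Proof.
move=> fK /is_derive_epsP dP; have K0 := lipschitz_with_ge0 fK.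
apply/ler_addgt0Pl => e e0; have [r r0 /(_ (r / 2))] := dP e e0.
have r20 : 0 < r / 2 by rewrite divr_gt0.
rewrite gt_eqF// gtr0_norm// => /(_ isT) h.
have {}h := h (ltac:(by rewrite ltr_pdivrMr// ltr_pMr// ltr1n)).
rewrite -(subrK ((r / 2)^-1 *: (f (r / 2 + t) - f t)) v).
apply: le_trans (ler_normD _ _) _; apply: lerD => //.
rewrite normrZ gtr0_norm ?invr_gt0// mulrC ler_pdivrMr//.
by apply: le_trans (fK _ _) _; rewrite addrK gtr0_norm.
Qed.

Lemma A2_lipschitz a K f C (df : R -> V) : 0 <= a ->
  lipschitz_with K f -> countable C ->
  (forall t, t \in `[0, a] -> ~ C t -> is_derive t 1 f (df t)) -> A2 a f.
Proof.
move=> a0 fK cC fdf; have K0 := lipschitz_with_ge0 fK; split.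
  move=> e e0; have K1 : 0 < K + 1 by rewrite ltr_wpDl.
  exists (e / (K + 1)); first by rewrite divr_gt0.
  move=> n l r lr _ sd.
  apply: (@le_lt_trans _ _ ((K + 1) * \sum_(i < n) (r i - l i))).
    rewrite mulr_sumr; apply: ler_sum => i _; have [/andP[_ lri] _] := lr i.
    apply: le_trans (fK _ _) _; rewrite ger0_norm ?subr_ge0//.
    by rewrite ler_wpM2r ?subr_ge0// lerDl.
  by rewrite mulrC -ltr_pdivlMr.
exists (fun t => \1_(~` C) t *: df t).
  apply: (@L2fun_bounded _ _ _ _ K a0).
    exact: strongly_measurable_derivative fK cC fdf.
  move=> t ta; rewrite indicE; have [Ct|nCt] := pselect (C t).
    by rewrite memNset ?scale0r ?normr0// => /(_ Ct).
  by rewrite mem_set ?scale1r//; exact: derivative_bound fK (fdf t ta nCt).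
exists C; split; first exact: countable_measurable.
  exact: countable_lebesgue_measure0.
move=> t /= nt; apply: contrapT => nCt; apply: nt => ta.
rewrite indicE mem_set ?scale1r//; exact: fdf.
Qed.

End lipschitz_A2.

(** * Integration off countable sets *)

Section integral_off_countable.
Context {R : realType}.
Local Notation leb := (@lebesgue_measure R).
Implicit Types (C D : set R) (f g : R -> \bar R).

(** Every subset of a countable set is measurable, so the values on [C] are arbitrary. This covers
    the integrands containing [L], whose measurability comes from their formula off [C]. *)
Lemma measurable_fun_off_countable C D f g : measurable D -> countable C ->
  measurable_fun D g -> (forall t, D t -> ~ C t -> f t = g t) ->
  measurable_fun D f.
Proof.
move=> mD cC mg fg _ B mB.
have -> : D `&` f @^-1` B =
    ((D `&` g @^-1` B) `&` ~` C) `|` ((D `&` f @^-1` B) `&` C).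
  apply/seteqP; split=> t /=.
    move=> [Dt ft]; have [Ct|nCt] := pselect (C t); first by right.
    by left; rewrite -fg.
  by move=> [[[Dt gt] nCt]|[]//]; split=> //; rewrite fg.
apply: measurableU.
  apply: measurableI; first exact: mg.
  by apply: measurableC; exact: countable_measurable.
apply: countable_measurable => //; apply: sub_countable cC.
by apply: subset_card_le => t [].
Qed.

Lemma integral_off_countable C D f g : measurable D -> countable C ->
  measurable_fun D g -> (forall t, D t -> ~ C t -> f t = g t) ->
  (\int[leb]_(t in D) f t = \int[leb]_(t in D) g t)%E.
Proof.
move=> mD cC mg fg; apply: ae_eq_integral => //.
  exact: measurable_fun_off_countable fg.
exists C; split; first exact: countable_measurable.
  exact: countable_lebesgue_measure0.
move=> t /= nt; apply: contrapT => nCt; apply: nt => Dt; exact: fg.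
Qed.

End integral_off_countable.

Section lipschitz_FTC.
Context {R : realType}.
Local Notation leb := (@lebesgue_measure R).
Implicit Types (g dg F : R -> R) (a K : R) (C : set R).

Lemma lipschitz_continuous K g : lipschitz_with K g -> continuous g.
Proof.
move=> gK t; have K1 : 0 < K + 1 by rewrite ltr_wpDl// (lipschitz_with_ge0 gK).
apply/cvgrPdist_le => e e0; near=> s.
apply: le_trans (gK _ _) _; apply: (@le_trans _ _ ((K + 1) * `|t - s|)).
  by rewrite ler_wpM2r// lerDl.
rewrite mulrC -ler_pdivlMr//; near: s.
by apply: cvgr_dist_le; rewrite ?divr_gt0//; exact: cvg_id.
Unshelve. all: by end_near. Qed.

Lemma is_derive_shift (f : R -> R) (h t v : R) :
  is_derive (h + t) 1 f v -> is_derive t 1 (fun s => f (h + s)) v.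
Proof.
move=> /is_derive_epsP dP; apply/is_derive_epsP => e /dP[r r0 rP].
by exists r => // k k0 kr; rewrite addrCA; exact: rP.
Qed.

(** Integrating from -1 makes the derivative at 0 two-sided. *)
Lemma lipschitz_primitive K g a : lipschitz_with K g -> 0 < a -> exists F,
  forall t, -1 < t -> t < a -> is_derive t 1 F (g t).
Proof.
move=> gK a0; have cg := lipschitz_continuous gK.
exists (fun x => \int[leb]_(t in [set` `[-1, x]]) (g t))%R => t t1 ta.
have ig : leb.-integrable `[-1, a] (EFin \o g).
  apply: continuous_compact_integrable; first exact: segment_compact.
  exact: continuous_subspaceT.
have [df Ef] := continuous_FTC1_closed ta ig t1 (cg t).
by apply: DeriveDef => //; rewrite -derive1E.
Qed.

Lemma measurable_derivative K g C dg (a : R) : lipschitz_with K g -> countable C ->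
  (forall t, t \in `[0, a] -> ~ C t -> is_derive t 1 g (dg t)) ->
  measurable_fun `[0, a] (fun t => \1_(~` C) t * dg t).
Proof.
move=> gK cC gdg; have [q sq qg] := @strongly_measurable_derivative _ _ _ _ _ _ _ gK cC gdg.
apply/measurable_EFinP.
apply: (emeasurable_fun_cvg (fun n x => (q n x)%:E)) => [n|t ta].
  apply/measurable_EFinP; have [m [A [v [mA ->]]]] := sq n.
  apply: measurable_funTS; apply: measurable_sum => i.
  by apply: measurable_funM => //; exact: measurable_indic.
by apply: cvg_EFin; [exact: nearW|exact: qg].
Qed.

(** The forward quotient [q n] of [g] has as antiderivative the forward quotient [Q n] of a
    primitive of [g], and [Q n a - Q n 0] tends to [g a - g 0]. Dominated convergence with bound [K]
    handles the integrals of [q n]. *)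
Lemma lipschitz_FTC K g C dg a : 0 < a -> lipschitz_with K g -> countable C ->
  (forall t, t \in `[0, a] -> ~ C t -> is_derive t 1 g (dg t)) ->
  leb.-integrable `[0, a] (fun t => (\1_(~` C) t * dg t)%:E) /\
  (\int[leb]_(t in `[0%R, a]) (\1_(~` C) t * dg t)%:E = (g a - g 0)%:E)%E.
Proof.
move=> a0 gK cC gdg; have K0 := lipschitz_with_ge0 gK.
(* [Q n] is differentiated up to [a + 1] and [h n <= 1], so the primitive must reach [a + 2]. *)
have a2 : 0 < a + 2 by rewrite addr_gt0.
have a_lt : a < a + 1 by rewrite ltrDl.
have cg := lipschitz_continuous gK.
have [F dF] := lipschitz_primitive gK a2.
pose h n : R := n.+1%:R^-1; have h0 n : 0 < h n by rewrite invr_gt0.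
have h1 n : h n <= 1 by rewrite invf_le1// ler1n.
pose q n t := (h n)^-1 * (g (h n + t) - g t).
have cq n : continuous (q n).
  exact: lipschitz_continuous (lipschitz_quotient (h0 n) gK).
have qK n t : `|q n t| <= K.
  rewrite normrM gtr0_norm ?invr_gt0// mulrC ler_pdivrMr//.
  by apply: le_trans (gK _ _) _; rewrite addrK gtr0_norm.
pose Q n t := (h n)^-1 * (F (h n + t) - F t).
have dQ n t : -1 < t -> t < a + 1 -> is_derive t 1 (Q n) (q n t).
  move=> t1 ta.
  have dF1 : is_derive (h n + t) 1 F (g (h n + t)).
    by apply: dF; have := h0 n; have := h1 n; lra.
  have dF2 : is_derive t 1 F (g t) by apply: dF => //; lra.
  have dF3 := is_derive_shift dF1.
  exact: is_deriveZ.
have cQ n t : -1 < t -> t < a + 1 -> {for t, continuous (Q n)}.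
  move=> t1 ta; apply: differentiable_continuous; apply/derivable1_diffP.
  by have [] := dQ n t t1 ta.
have iQ n : (\int[leb]_(t in `[0%R, a]) (q n t)%:E = (Q n a - Q n 0)%:E)%E.
  rewrite (@continuous_FTC2 _ (q n) (Q n) 0 a a0) ?EFinB//.
  - exact: continuous_subspaceT.
  - split.
    + move=> t /[!in_itv]/= /andP[t0 ta].
      by have [] := dQ n t (lt_trans (ltrN10 _) t0) (lt_trans ta a_lt).
    + apply: cvg_at_right_filter; apply: cQ; rewrite ?ltrN10 ?addr_gt0//.
    + apply: cvg_at_left_filter; apply: cQ; rewrite ?ltrDl//.
      exact: lt_trans (ltrN10 _) a0.
  - move=> t /[!in_itv]/= /andP[t0 ta].
    have [dd <-] := dQ n t (lt_trans (ltrN10 _) t0) (lt_trans ta a_lt).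
    by rewrite derive1E.
have hl : h n @[n --> \oo] --> 0 := @cvg_harmonic R.
have dql (f : R -> R) (t v : R) : is_derive t 1 f v ->
    (h n)^-1 * (f (h n + t) - f t) @[n --> \oo] --> v.
  move=> /is_derive_epsP fP; apply/cvgrPdist_le => e e0.
  have [r r0 rP] := fP e e0; have /cvgr0Pnorm_lt/(_ _ r0) := hl.
  by apply: filterS => n; apply: rP; rewrite gt_eqF.
have Ql : (Q n a - Q n 0)%:E @[n --> \oo] --> (g a - g 0)%:E.
  apply: cvg_EFin; first exact: nearW.
  apply: cvgB; apply: dql; apply: dF; rewrite ?ltrN10 ?addr_gt0 ?ltrDl//.
  exact: lt_trans (ltrN10 _) a0.
have mq n : measurable_fun `[0, a] (EFin \o q n).
  apply/measurable_EFinP; apply: measurable_funTS.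
  exact: continuous_measurable_fun.
have [||||intg _ lim_int] := @dominated_convergence _ _ R leb `[0, a]%classic
  (measurable_itv _) (fun n => EFin \o q n)
  (fun t => (\1_(~` C) t * dg t)%:E) (cst K%:E) mq.
- by apply/measurable_EFinP; exact: measurable_derivative gK cC gdg.
- exists C; split; first exact: countable_measurable.
    exact: countable_lebesgue_measure0.
  move=> t /= nt; apply: contrapT => nCt; apply: nt => ta.
  rewrite indicE mem_set// mul1r; apply: cvg_EFin; first exact: nearW.
  by apply: dql; exact: gdg.
- apply: (continuous_compact_integrable (f := cst K)).
    exact: segment_compact.
  by apply: continuous_subspaceT; exact: cst_continuous.
- by apply: aeW => t n _; rewrite lee_fin qK.
split => //; rewrite -(cvg_lim _ lim_int)//; apply: cvg_lim => //.
rewrite [X in X @ _ --> _](_ : _ = fun n => (Q n a - Q n 0)%:E)//.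
by apply/funext => n; exact: iQ.
Qed.

End lipschitz_FTC.

(** * Null sets and Fubini's theorem on rectangles *)

Section product_null_sets.
Context {R : realType}.
Local Notation leb := (@lebesgue_measure R).

Lemma measurable_diagonal : measurable [set z : R * R | z.1 = z.2].
Proof.
have -> : [set z : R * R | z.1 = z.2] =
    setT `&` (fun z : R * R => z.1 - z.2) @^-1` [set 0].
  rewrite setTI; apply/seteqP; split=> [z /= ->|z /= /eqP]; rewrite ?subrr//.
  by rewrite subr_eq0 => /eqP.
by apply: measurable_funB.
Qed.

Lemma measurable_ltr_set d (X : measurableType d) (f g : X -> R) :
  measurable_fun setT f -> measurable_fun setT g ->
  measurable [set x | f x < g x].
Proof.
move=> mf mg; rewrite -[X in measurable X]setTI.
by have := measurable_fun_ltr mf mg => /(_ measurableT [set true]); apply.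
Qed.

Lemma ae_product_off_countable (C : set R) : countable C ->
  {ae (leb \x leb)%E, forall z : R * R, [/\ ~ C z.1, ~ C z.2 & z.1 != z.2]}.
Proof.
move=> cC; have mC : measurable C by exact: countable_measurable.
have C0 : leb C = 0 by exact: countable_lebesgue_measure0.
have n1 : (leb \x leb)%E.-negligible (C `*` setT).
  exists (C `*` setT); split => //; first exact: measurableX.
  by rewrite product_measure1E//= C0 mul0e.
have n2 : (leb \x leb)%E.-negligible (setT `*` C).
  exists (setT `*` C); split => //; first exact: measurableX.
  by rewrite product_measure1E//= C0 mule0.
have n3 : (leb \x leb)%E.-negligible [set z : R * R | z.1 = z.2].
  exists [set z : R * R | z.1 = z.2]; split => //; first exact: measurable_diagonal.
  rewrite /product_measure1/= integral0_eq// => s _.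
  rewrite (_ : xsection _ s = [set s]) ?lebesgue_measure_set1//.
  by apply/seteqP; split=> t; rewrite /xsection/= inE.
apply: negligibleS (negligibleU (negligibleU n1 n2) n3) => z /= nz.
apply: contrapT => /not_orP[/not_orP[nC1 nC2] nd]; apply: nz; split.
- by move=> C1; apply: nC1.
- by move=> C2; apply: nC2.
- exact/eqP.
Qed.

End product_null_sets.

Section rectangle_Fubini.
Context {R : realType}.
Local Notation leb := (@lebesgue_measure R).

Lemma Fubini_rectangle (a b M : R) (F : R * R -> R) :
  measurable_fun (`[0, a] `*` `[0, b]) F ->
  (forall z, (`[0, a] `*` `[0, b])%classic z -> `|F z| <= M) ->
  leb.-integrable `[0, a]
    (fun s => \int[leb]_(t in `[0%R, b]) (F (s, t))%:E)%E /\
  (\int[leb]_(s in `[0%R, a]) \int[leb]_(t in `[0%R, b]) (F (s, t))%:E =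
   \int[leb]_(t in `[0%R, b]) \int[leb]_(s in `[0%R, a]) (F (s, t))%:E)%E.
Proof.
move=> mF FM; set box := `[0, a] `*` `[0, b] in mF FM.
have mbox : measurable box by apply: measurableX.
have iF : (leb \x leb)%E.-integrable box (EFin \o F).
  apply: measurable_bounded_integrable => //.
    rewrite /= product_measure1E//= !lebesgue_measure_itv/=.
    by case: ifP => _; case: ifP => _;
      rewrite ?mul0e ?mule0 -?EFinB -?EFinM ?ltry.
  exists M; split; first exact: num_real.
  by move=> x Mx z /FM/le_trans; apply; exact: ltW.
(* Extension by zero makes the global Fubini sections agree with the integrals over the sides. *)
have {}iF : (leb \x leb)%E.-integrable setT ((EFin \o F) \_ box).
  exact: (proj1 (@integrable_mkcond _ _ _ (leb \x leb)%E box (EFin \o F) mbox)) iF.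
have E1 : fubini_F leb ((EFin \o F) \_ box) =
    (fun s => \int[leb]_(t in `[0%R, b]) (F (s, t))%:E)%E \_ `[0, a].
  apply/funext => s; rewrite /fubini_F patchE; case: ifPn => sa.
    rewrite [RHS]integral_mkcond; apply: eq_integral => t _; rewrite !patchE.
    by rewrite /box in_setX/= sa.
  rewrite integral0_eq// => t _; rewrite patchE /box in_setX/=.
  by rewrite (negPf sa).
have E2 : fubini_G leb ((EFin \o F) \_ box) =
    (fun t => \int[leb]_(s in `[0%R, a]) (F (s, t))%:E)%E \_ `[0, b].
  apply/funext => t; rewrite /fubini_G patchE; case: ifPn => tb.
    rewrite [RHS]integral_mkcond; apply: eq_integral => s _; rewrite !patchE.
    by rewrite /box in_setX/= tb andbT.
  rewrite integral0_eq// => s _; rewrite patchE /box in_setX/=.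
  by rewrite (negPf tb) andbF.
split.
  apply/integrable_mkcond => //; rewrite -E1; exact: integrable_fubini_F.
rewrite [LHS]integral_mkcond [RHS]integral_mkcond -E1 -E2.
exact: Fubini.
Qed.

End rectangle_Fubini.

(** * The characteristic solution and its partial derivatives *)

Section characteristic_curve.
Context {R : realType} {V : normedModType R}.
Variables (y d : R -> V) (N : R) (C : set R).
Hypotheses (yN : lipschitz_with N y) (cC : countable C)
  (yd : forall t, 0 <= t -> ~ C t -> is_derive t 1 y (d t)).
Implicit Types (s t a : R).

(* Cutting [d] off at the exceptional points makes it measurable everywhere. *)
Definition slope t : V := \1_(~` C) t *: d t.

Lemma slope_off t : ~ C t -> slope t = d t.
Proof. by move=> nC; rewrite /slope indicE mem_set// scale1r. Qed.

Lemma slope_on t : C t -> slope t = 0.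
Proof. by move=> Ct; rewrite /slope indicE memNset ?scale0r// => /(_ Ct). Qed.

Lemma slope_le t : 0 <= t -> `|slope t| <= N.
Proof.
move=> t0; have [Ct|nCt] := pselect (C t).
  by rewrite slope_on// normr0 (lipschitz_with_ge0 yN).
by rewrite slope_off//; exact: derivative_bound yN (yd t0 nCt).
Qed.

Lemma strongly_measurable_slope a : strongly_measurable `[0, a] slope.
Proof.
apply: strongly_measurable_derivative yN cC _ => t /[!in_itv]/= /andP[t0 _].
exact: yd.
Qed.

Lemma lipschitz_min s : lipschitz_with N (fun t => y (Num.min s t)).
Proof.
move=> t t'; apply: le_trans (yN _ _) _.
rewrite ler_wpM2l ?(lipschitz_with_ge0 yN)//.
have [st|ts] := leP s t; have [st'|ts'] := leP s t'.
- by rewrite subrr normr0.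
- rewrite ler0_norm; last lra.
  rewrite ler0_norm; lra.
- rewrite ger0_norm; last lra.
  rewrite ger0_norm; lra.
- by [].
Qed.

Lemma lipschitz_min_le s s' t : `|y (Num.min s' t) - y (Num.min s t)| <= N * `|s' - s|.
Proof. by rewrite minC (minC s); exact: lipschitz_min. Qed.

Lemma is_derive_min s t : 0 <= t -> ~ C t -> t != s ->
  is_derive t 1 (fun t => y (Num.min s t)) ((t < s)%R%:R *: slope t).
Proof.
move=> t0 nCt; rewrite slope_off// neq_lt => /orP[ts|st].
  have /is_derive_epsP yP := yd t0 nCt.
  rewrite ts scale1r; apply/is_derive_epsP => e /yP[r r0 rP].
  exists (Num.min r (s - t)); first by rewrite lt_min r0 subr_gt0.
  move=> h h0; rewrite lt_min => /andP[hr hs].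
  rewrite !min_r ?(ltW ts)//; first exact: rP.
  by have := ler_norm h; lra.
rewrite ltNge (ltW st)/= scale0r; apply/is_derive_epsP => e e0.
exists (t - s); first by rewrite subr_gt0.
move=> h h0 hs; rewrite !min_l ?(ltW st)// ?subrr ?scaler0 ?subrr ?normr0 ?ltW//.
by have := ler_norm (- h); rewrite normrN; lra.
Qed.

End characteristic_curve.

Lemma countable_setU1 T (A : set T) (x : T) : countable A ->
  countable (A `|` [set x]).
Proof.
move=> cA; rewrite -bigcup2E; by apply: bigcup_countable => // -[|[|i]] _ /=.
Qed.

Section curve_in_L2.
Context {R : realType} {V : normedModType R}.
Variables (y d : R -> V) (N : R) (C : set R).
Hypotheses (yN : lipschitz_with N y) (cC : countable C)
  (yd : forall t, 0 <= t -> ~ C t -> is_derive t 1 y (d t)).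
Variables (T : R) (T0 : 0 < T).
Implicit Types (s t : R).

Local Notation slope := (slope d C).

Lemma L2fun_lipschitz K (f : R -> V) : lipschitz_with K f -> L2fun T f.
Proof.
move=> fK; apply: (@L2fun_bounded _ _ _ _ (`|f 0| + K * T) (ltW T0)).
  exact: strongly_measurable_lipschitz fK.
move=> t /[!in_itv]/= /andP[t0 tT]; rewrite -(subrK (f 0) (f t)) addrC.
apply: le_trans (ler_normD _ _) _; rewrite lerD2l.
apply: le_trans (fK _ _) _; rewrite subr0 ger0_norm//.
by rewrite ler_wpM2l// (lipschitz_with_ge0 fK).
Qed.

Definition curve s : L2 T V := toL2 T (fun t => y (Num.min s t)).

Lemma L2fun_min s : L2fun T (fun t => y (Num.min s t)).
Proof. exact: L2fun_lipschitz (lipschitz_min yN s). Qed.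

Lemma lipschitz_curve : lipschitz_with (N * Num.sqrt T) curve.
Proof.
move=> s s'; have N0 := lipschitz_with_ge0 yN.
rewrite /curve -toL2B; try exact: L2fun_min.
have Lb := L2funB (L2fun_min s') (L2fun_min s).
rewrite -(ler_pXn2r (n := 2))// ?nnegrE ?mulr_ge0 ?sqrtr_ge0//.
rewrite (_ : (N * _ * _) ^+ 2 = (N * `|s' - s|) ^+ 2 * T + 0 * (0 - 0)); last first.
  by rewrite !exprMn sqr_sqrtr ?(ltW T0)//; ring.
apply: norm_toL2_le => //; rewrite ?sqr_ge0 ?(ltW T0)//.
move=> t _; rewrite mul0r addr0 lerXn2r ?nnegrE ?mulr_ge0//.
exact: lipschitz_min_le.
Qed.

Lemma L2fun_slope s : 0 <= s -> L2fun T (fun t => (s < t)%R%:R *: slope s).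
Proof.
move=> s0; apply: (@L2fun_bounded _ _ _ _ N (ltW T0)).
  have c0 : lipschitz_with 0 (cst (slope s) : R -> V).
    by move=> u v; rewrite subrr normr0 mul0r.
  have sm := strongly_measurable_lipschitz T c0.
  apply: (@strongly_measurable_eq _ _ _ _ _ (fun t => \1_(`]s, +oo[%classic) t *: slope s)).
    by move=> t _; rewrite indicE mem_setE in_itv/= andbT.
  exact: strongly_measurable_indic sm.
move=> t _; have := slope_le yN yd s0.
case: (s < t); rewrite ?scale1r// scale0r normr0 => _.
exact: lipschitz_with_ge0 yN.
Qed.

(** For [t] before both [s] and [h + s] the error is 0; after both it is that of the quotient of [y]
    at [s]. In between it is at most [2 N], on an interval of length [|h|], so its squared norm is
    of order [|h|]. *)
Lemma is_derive_curve s : 0 <= s -> ~ C s ->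
  is_derive s 1 curve (toL2 T (fun t => (s < t)%R%:R *: slope s)).
Proof.
move=> s0 nCs; have N0 := lipschitz_with_ge0 yN.
have /is_derive_epsP ys := yd s0 nCs; have Ls := L2fun_slope s0.
apply/is_derive_epsP => e e0.
(* Chosen so that [e1 ^+ 2 * T <= e ^+ 2 / 4]; the second bound on [|h|] below gives
   [4 N^2 |h| <= e^2 / 2]. *)
pose e1 := e / (2 * (T + 1)).
have T1 : 0 < 2 * (T + 1) by rewrite mulr_gt0// ltr_wpDl// ltW.
have e10 : 0 < e1 by rewrite divr_gt0.
have [r r0 rP] := ys e1 e10.
have K0 : 0 < 8 * N ^+ 2 + 1 by rewrite ltr_wpDl// mulr_ge0// sqr_ge0.
exists (Num.min r (e ^+ 2 / (8 * N ^+ 2 + 1))).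
  by rewrite lt_min r0 divr_gt0// exprn_gt0.
move=> h h0; rewrite lt_min => /andP[hr]; rewrite ltr_pdivlMr// => he.
have Lh := L2funB (L2fun_min (h + s)) (L2fun_min s).
rewrite /curve -toL2B; try exact: L2fun_min.
rewrite -toL2Z// -toL2B//; last exact: L2funZ.
rewrite -(ler_pXn2r (n := 2))// ?nnegrE ?(ltW e0)//.
pose b := Num.min s (h + s); pose c := Num.max s (h + s).
have cb : c - b = `|h|.
  rewrite /c /b; have [h1|h1] := leP s (h + s).
    by rewrite ger0_norm; lra.
  by rewrite ltr0_norm; lra.
have bc : b <= c by rewrite -subr_ge0 cb.
apply: (@le_trans _ _ (e1 ^+ 2 * T + (2 * N) ^+ 2 * (c - b))); last first.
  have e1T : e1 ^+ 2 * T <= e ^+ 2 / 4.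
    rewrite /e1 expr_div_n mulrAC ler_pdivrMr ?exprn_gt0//.
    rewrite (_ : _ / 4 * _ = e ^+ 2 * (T + 1) ^+ 2); last by field.
    rewrite ler_wpM2l ?sqr_ge0//; have := ltW T0; have := sqr_ge0 T; nra.
  rewrite cb; move: he; have := normr_ge0 h; have := sqr_ge0 e; nra.
apply: norm_toL2_le; rewrite ?sqr_ge0 ?(ltW T0)//.
  by apply: L2funB => //; exact: L2funZ.
move=> t /[!in_itv]/= /andP[t0 tT].
have eE : ((fun t => (s < t)%R%:R *: slope s) - (h^-1 *: ((fun t => y (Num.min (h + s) t)) -
   (fun t => y (Num.min s t))))) t = (s < t)%R%:R *: slope s - h^-1 *:
   (y (Num.min (h + s) t) - y (Num.min s t)) by [].
rewrite eE.
have [tb|bt] := ltP t b.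
  have [ts th] : t < s /\ t < h + s by move: tb; rewrite lt_min => /andP.
  rewrite !min_r ?(ltW ts) ?(ltW th)// subrr scaler0 subr0.
  rewrite ltNge (ltW ts)/= scale0r normr0 expr0n/=.
  by rewrite addr_ge0 ?sqr_ge0// mulr_ge0 ?sqr_ge0.
have [ct|tc] := ltP c t.
  have [ts th] : s < t /\ h + s < t by move: ct; rewrite gt_max => /andP.
  rewrite !min_l ?(ltW ts) ?(ltW th)// ts scale1r slope_off//.
  apply: ler_wpDr; first by rewrite mulr_ge0 ?sqr_ge0.
  by rewrite lerXn2r ?nnegrE ?(ltW e10)//; exact: rP.
rewrite indicE mem_set ?mulr1; last by rewrite /= in_itv/= bt tc.
apply: ler_wpDl; first exact: sqr_ge0.
rewrite lerXn2r ?nnegrE ?mulr_ge0//; apply: le_trans (ler_normB _ _) _.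
rewrite mulrDl mul1r; apply: lerD.
  have := slope_le yN yd s0; case: (s < t); rewrite ?scale1r// scale0r normr0//.
rewrite normrZ normfV mulrC ler_pdivrMr ?normr_gt0//.
by apply: le_trans (lipschitz_min_le yN s (h + s) t) _; rewrite addrK.
Qed.

End curve_in_L2.

(** * Energy balance *)

Section energy.
Context {R : realType} {H : hilbertType R}.
Implicit Types (f : R -> H) (s t : R).
Local Notation leb := (@lebesgue_measure R).

Lemma is_derive_half_sqr f t v : is_derive t 1 f v ->
  is_derive t 1 (fun t => 2^-1 * inner (f t) (f t)) (inner (f t) v).
Proof.
move=> /is_derive_epsP fP; apply/is_derive_epsP => e e0.
pose A := `|f t| + 1; pose B := `|v| + 1.
have A0 : 0 < A by rewrite ltr_wpDl. have B0 : 0 < B by rewrite ltr_wpDl.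
have e1 : 0 < Num.min 1 (e / 2 / A) by rewrite lt_min ltr01 !divr_gt0.
have [r r0 rP] := fP _ e1.
exists (Num.min r (e / B ^+ 2)); first by rewrite lt_min r0 divr_gt0// exprn_gt0.
move=> h h0; rewrite lt_min => /andP[hr]; rewrite ltr_pdivlMr ?exprn_gt0// => hB.
have := rP h h0 hr; set w := h^-1 *: (f (h + t) - f t).
have -> : f (h + t) = f t + h *: w.
  by rewrite /w scalerA divff// scale1r [RHS]addrC subrK.
move: w => w; rewrite le_min => /andP[w1 w2].
have wB : `|w| <= B.
  rewrite -(subrK v w); apply: le_trans (ler_normD _ _) _.
  by rewrite distrC addrC lerD2l.
have -> : inner (f t) v - h^-1 * (2^-1 * inner (f t + h *: w) (f t + h *: w)
    - 2^-1 * inner (f t) (f t)) = inner (f t) (v - w) - h / 2 * inner w w.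
  by rewrite !innerLR (innerC w (f t)); field.
apply: le_trans (ler_normB _ _) _; rewrite [leRHS]splitr; apply: lerD.
  apply: le_trans (inner_norm_le _ _) _.
  apply: (@le_trans _ _ (A * (e / 2 / A))).
    by apply: ler_pM => //; rewrite lerDl.
  by rewrite mulrC divfK// gt_eqF.
rewrite normrM (ger0_norm (inner_ge0 _)) innerE normrM (gtr0_norm (x := 2^-1))//.
have : `|w| ^+ 2 <= B ^+ 2 by rewrite lerXn2r ?nnegrE// ltW.
have := normr_ge0 h; nra.
Qed.

Lemma lipschitz_half_sqr K M f : (forall t, `|f t| <= M) -> lipschitz_with K f ->
  lipschitz_with (M * K) (fun t => 2^-1 * inner (f t) (f t)).
Proof.
move=> fM fK s t.
have -> : 2^-1 * inner (f t) (f t) - 2^-1 * inner (f s) (f s) =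
    2^-1 * inner (f t + f s) (f t - f s).
  by rewrite !innerLR (innerC (f s) (f t)); ring.
rewrite normrM gtr0_norm//; have := inner_norm_le (f t + f s) (f t - f s).
have : `|f t + f s| * `|f t - f s| <= (M + M) * (K * `|t - s|).
  apply: ler_pM => //; apply: le_trans (ler_normD _ _) _; exact: lerD.
lra.
Qed.

Variables (y d : R -> H) (N : R) (C : set R) (x0 : H).
Hypotheses (yN : lipschitz_with N y) (cC : countable C)
  (yd : forall t, 0 <= t -> ~ C t -> is_derive t 1 y (d t))
  (y0 : forall t, t <= 0 -> y t = x0).
Local Notation slope := (slope d C).

(** Constancy before time 0 extends the bound to all [t <= s]; with stopping at [s], [kinetic s]
    becomes Lipschitz on the whole line. *)
Lemma characteristic_bound s t : t <= s -> `|y t| <= `|x0| + N * `|s|.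
Proof.
move=> ts; have N0 := lipschitz_with_ge0 yN.
have [t0|t0] := leP t 0; first by rewrite y0// lerDl mulr_ge0.
rewrite -(subrK x0 (y t)) addrC; apply: le_trans (ler_normD _ _) _.
rewrite lerD2l -(y0 (lexx 0)); apply: le_trans (yN _ _) _.
rewrite ler_wpM2l// subr0 gtr0_norm//; exact: le_trans (ler_norm s).
Qed.

Definition power t := inner (y t) (slope t).

Lemma power_le s t : 0 <= t -> t <= s -> `|power t| <= (`|x0| + N * `|s|) * N.
Proof.
move=> t0 ts; apply: le_trans (inner_norm_le _ _) _.
by apply: ler_pM => //; [exact: characteristic_bound|exact: (slope_le yN yd t0)].
Qed.

Definition kinetic s t : R := 2^-1 * inner (y (Num.min s t)) (y (Num.min s t)).

Lemma lipschitz_kinetic s : lipschitz_with ((`|x0| + N * `|s|) * N) (kinetic s).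
Proof.
apply: lipschitz_half_sqr; last exact: lipschitz_min.
by move=> t; apply: characteristic_bound; rewrite ge_min lexx.
Qed.

Lemma integral_power s a : 0 <= s -> 0 < a ->
  leb.-integrable `[0, a] (fun t => ((t < s)%R%:R * power t)%:E) /\
  (\int[leb]_(t in `[0%R, a]) ((t < s)%R%:R * power t)%:E =
   (2^-1 * `|y (Num.min s a)| ^+ 2 - 2^-1 * `|x0| ^+ 2)%:E)%E.
Proof.
move=> s0 a0.
have cCs : countable (C `|` [set s]) by exact: countable_setU1.
have dk t : t \in `[0, a] -> ~ (C `|` [set s]) t ->
    is_derive t 1 (kinetic s) (inner (y (Num.min s t)) ((t < s)%R%:R *: slope t)).
  move=> /[!in_itv]/= /andP[t0 _] nC.
  apply: (@is_derive_half_sqr (fun t => y (Num.min s t))).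
  apply: (is_derive_min yd) => //; first by move=> Ct; apply: nC; left.
  by apply/eqP => ts; apply: nC; right.
have := lipschitz_FTC a0 (lipschitz_kinetic s) cCs dk.
rewrite /kinetic (min_r s0) (y0 (lexx 0)) !innerE.
(* The cut-off at [C] and [s] is already contained in [slope] and in the strict inequality
   [t < s]. *)
rewrite (_ : (fun t => (_ * inner _ _)%:E) = (fun t => ((t < s)%R%:R * power t)%:E))//.
apply/funext => t; congr EFin; rewrite innerZr /power.
have [ts|st] := ltP t s; last by rewrite !mul0r mulr0.
have [Ct|nCt] := pselect (C t).
  by rewrite slope_on// (innerC _ 0) -(scale0r (0 : H)) innerZl !(mul0r, mulr0).
rewrite indicE mem_set ?mul1r// => -[//|ts']; by rewrite ts' ltxx in ts.
Qed.

End energy.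

Section solution.
Context {R : realType} {H : hilbertType R}.
Implicit Types (s t : R).
Local Notation leb := (@lebesgue_measure R).
Variables (L : H * H -> R) (y d : R -> H) (N : R) (C : set R) (x0 : H).
Hypotheses (yN : lipschitz_with N y) (cC : countable C)
  (yd : forall t, 0 <= t -> ~ C t -> is_derive t 1 y (d t))
  (y0 : forall t, t <= 0 -> y t = x0)
  (Gy : forall t, flow_graph L (y t, d t)).
Local Notation slope := (slope d C).
Local Notation power := (power y d C).

(** Together with [slope_s], the partial derivatives of [y (min s t)] off the diagonal and [C]; at
    most one of the two is nonzero. *)
Definition slope_t s t : H := (t < s)%R%:R *: slope t.

Definition slope_s s t : H := (s < t)%R%:R *: slope s.

Lemma slope_sum_graph s t : ~ C s -> ~ C t -> s != t ->
  flow_graph L (y (Num.min s t), slope_t s t + slope_s s t).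
Proof.
move=> nCs nCt; rewrite neq_lt /slope_t /slope_s => /orP[st|ts].
  by rewrite (min_l (ltW st)) st ltNge (ltW st)/= scale0r add0r scale1r slope_off.
by rewrite (min_r (ltW ts)) ts ltNge (ltW ts)/= scale0r addr0 scale1r slope_off.
Qed.

Lemma cost_power s t : ~ C s -> ~ C t -> s != t ->
  L (y (Num.min s t), slope_t s t + slope_s s t) =
  - ((t < s)%R%:R * power t) - (s < t)%R%:R * power s.
Proof.
move=> nCs nCt st; have := slope_sum_graph nCs nCt st.
rewrite /flow_graph/= => ->; move: st.
rewrite neq_lt /slope_t /slope_s /power => /orP[st|ts].
  rewrite (min_l (ltW st)) st ltNge (ltW st)/= scale0r add0r scale1r.
  by rewrite mul0r mul1r oppr0 add0r.
rewrite (min_r (ltW ts)) ts ltNge (ltW ts)/= scale0r addr0 scale1r.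
by rewrite mul0r mul1r subr0.
Qed.

Variables (S T : R) (S0 : 0 < S) (T0 : 0 < T).

Let energy_gain s : R := 2^-1 * `|y s| ^+ 2 - 2^-1 * `|x0| ^+ 2.

Let integrable_gain (b c : R) :
  leb.-integrable `[0, c] (fun s => (energy_gain (Num.min s b))%:E).
Proof.
have gainE : lipschitz_with ((`|x0| + N * `|b|) * N)
    (fun s => energy_gain (Num.min s b)).
  move=> s t; rewrite (_ : _ - _ = kinetic y b t - kinetic y b s).
    exact: lipschitz_kinetic.
  by rewrite /kinetic /energy_gain !innerE ![Num.min b _]minC; ring.
apply: (continuous_compact_integrable (f := fun s => energy_gain (Num.min s b))).
  exact: segment_compact.
exact: continuous_subspaceT (lipschitz_continuous gainE).
Qed.

(** On [s < t] the power depends on [s] alone, so only integration in [s] produces an energy gain.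
    This half of the rectangle is therefore where Fubini's theorem enters. *)
Let integral_late_power : leb.-integrable `[0, S]
    (fun s => \int[leb]_(t in `[0%R, T]) ((s < t)%R%:R * power s)%:E)%E /\
  (\int[leb]_(s in `[0%R, S]) \int[leb]_(t in `[0%R, T])
     ((s < t)%R%:R * power s)%:E =
   \int[leb]_(t in `[0%R, T]) (energy_gain (Num.min S t))%:E)%E.
Proof.
have mpower : measurable_fun `[0, S] power.
  (* The horizon [S + 1] exceeds every point of [[0, S]], so the factor from the strict inequality
     is 1 there. *)
  have S1 : 0 <= S + 1 by rewrite addr_ge0// ltW.
  have [/integrableP[/measurable_EFinP mp _] _] :=
    integral_power yN cC yd y0 S1 S0.
  apply: eq_measurable_fun mp => t /[!inE]/= /[!in_itv]/= /andP[_ tS].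
  by rewrite (le_lt_trans tS) ?ltrDl// mul1r.
have [] := @Fubini_rectangle _ S T ((`|x0| + N * `|S|) * N)
   (fun z => (z.1 < z.2)%R%:R * power z.1).
- apply: measurable_funM.
    rewrite (_ : (fun z => _) = \1_[set z : R * R | z.1 < z.2]).
      by apply: measurable_funTS; apply: measurable_indic; exact: measurable_ltr_set.
    by apply/funext => z; rewrite indicE mem_setE.
  apply: (measurable_comp (F := `[0, S])) mpower _ => //.
    by move=> _ [z [] + _ <-].
  exact: measurable_funTS measurable_fst.
- move=> [s t]/= [] /[!in_itv]/= /andP[s0 sS] _.
  have := power_le yN yd y0 s0 sS; case: (s < t); rewrite ?mul1r// mul0r normr0.
  exact: le_trans.
move=> iJ ->; split => //; apply: eq_integral => t /[!inE]/= /[!in_itv]/= /andP[t0 _].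
by have [_ ->] := integral_power yN cC yd y0 t0 S0; rewrite minC.
Qed.

Lemma energy_identity :
  (0 = \int[leb]_(s in `[0%R, S]) \int[leb]_(t in `[0%R, T])
         (L (y (Num.min s t), slope_t s t + slope_s s t))%:E
     + \int[leb]_(s in `[0%R, S])
         (2^-1 * `|y (Num.min s 0)| ^+ 2 - 2 * inner (y (Num.min s 0)) x0
          + `|x0| ^+ 2 + 2^-1 * `|y (Num.min s T)| ^+ 2)%:E
     + \int[leb]_(t in `[0%R, T])
         (2^-1 * `|y (Num.min 0 t)| ^+ 2 - 2 * inner (y (Num.min 0 t)) x0
          + `|x0| ^+ 2 + 2^-1 * `|y (Num.min S t)| ^+ 2)%:E)%E.
Proof.
have [iJ EJ] := integral_late_power.
have iG := integrable_gain T S.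
have iG' : leb.-integrable `[0, T] (fun t => (energy_gain (Num.min S t))%:E).
  rewrite (_ : (fun t => _) = fun t => (energy_gain (Num.min t S))%:E).
    exact: integrable_gain.
  by apply/funext => t; rewrite minC.
(* The coefficients of [|x0|^2] add up to [1/2 - 2 + 1 = - 1/2]. *)
have boundary (x : H) : 2^-1 * `|x0| ^+ 2 - 2 * inner x0 x0 + `|x0| ^+ 2
    + 2^-1 * `|x| ^+ 2 = 2^-1 * `|x| ^+ 2 - 2^-1 * `|x0| ^+ 2.
  by rewrite innerE; lra.
have -> : (\int[leb]_(s in `[0%R, S])
         (2^-1 * `|y (Num.min s 0)| ^+ 2 - 2 * inner (y (Num.min s 0)) x0
          + `|x0| ^+ 2 + 2^-1 * `|y (Num.min s T)| ^+ 2)%:E =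
    \int[leb]_(s in `[0%R, S]) (energy_gain (Num.min s T))%:E)%E.
  apply: eq_integral => s /[!inE]/= /[!in_itv]/= /andP[s0 _].
  by rewrite (min_r s0) (y0 (lexx 0)) boundary.
have -> : (\int[leb]_(t in `[0%R, T])
         (2^-1 * `|y (Num.min 0 t)| ^+ 2 - 2 * inner (y (Num.min 0 t)) x0
          + `|x0| ^+ 2 + 2^-1 * `|y (Num.min S t)| ^+ 2)%:E =
    \int[leb]_(t in `[0%R, T]) (energy_gain (Num.min S t))%:E)%E.
  apply: eq_integral => t /[!inE]/= /[!in_itv]/= /andP[t0 _].
  by rewrite (min_l t0) (y0 (lexx 0)) boundary.
have -> : (\int[leb]_(s in `[0%R, S]) \int[leb]_(t in `[0%R, T])
         (L (y (Num.min s t), slope_t s t + slope_s s t))%:E =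
   \int[leb]_(s in `[0%R, S]) (- (energy_gain (Num.min s T))%:E -
     \int[leb]_(t in `[0%R, T]) ((s < t)%R%:R * power s)%:E))%E.
  (* [cost_power] holds off [C] and the diagonal: the outer integrand is identified off [C], the
     inner one off [C] and [s]. *)
  apply: (integral_off_countable (C := C)) => //.
    apply: emeasurable_funB; last by move/integrableP : iJ => [].
    by apply: measurableT_comp => //; move/integrableP : iG => [].
  move=> s /= /[!in_itv]/= /andP[s0 sS] nCs.
  have [ip Ep] := integral_power yN cC yd y0 s0 T0.
  have ic : leb.-integrable `[0, T] (fun t => ((s < t)%R%:R * power s)%:E).
    apply: measurable_bounded_integrable => //.
    - by rewrite /= lebesgue_measure_itv/=; case: ifP => // _; rewrite -EFinB ltry.
    - apply: measurable_funTS; apply: measurable_funM => //.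
      rewrite (_ : (fun t => _) = \1_(`]s, +oo[%classic)).
        by apply: measurable_indic; exact: measurable_itv.
      by apply/funext => t; rewrite indicE mem_setE in_itv/= andbT.
    - exists `|power s|; split; first exact: num_real.
      move=> M sM t _; apply: le_trans (ltW sM).
      by case: (s < t); rewrite ?mul1r// mul0r normr0.
  transitivity (\int[leb]_(t in `[0%R, T]) (- ((t < s)%R%:R * power t)%:E -
      ((s < t)%R%:R * power s)%:E))%E.
    apply: (integral_off_countable (C := C `|` [set s])) => //.
    - exact: countable_setU1.
    - apply: emeasurable_funB; last by move/integrableP : ic => [].
      by apply: measurableT_comp => //; move/integrableP : ip => [].
    - move=> t _ nC; rewrite cost_power// ?EFinB ?EFinN//.
        by move=> Ct; apply: nC; left.
      by apply/eqP => st; apply: nC; right.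
  rewrite integralB//; last exact: integrableN ip.
  by rewrite integralN ?Ep//; apply: integrable_add_def.
rewrite integralB//; last exact: integrableN iG.
rewrite integralN; last exact: integrable_add_def.
have /fineK E1 : (\int[leb]_(s in `[0%R, S])
    (energy_gain (Num.min s T))%:E)%E \is a fin_num by exact: integrable_fin_num.
have /fineK E2 : (\int[leb]_(t in `[0%R, T])
    (energy_gain (Num.min S t))%:E)%E \is a fin_num by exact: integrable_fin_num.
rewrite EJ -E1 -E2 -EFinN -!EFinD; congr EFin; ring.
Qed.

End solution.

(** * The solution on the rectangle *)

Section measurable_rectangle.
Context {R : realType} {V : normedModType R}.
Variables (S T : R).
Local Notation box := (`[0, S] `*` `[0, T])%classic.

Lemma strongly_measurable_fst (f : R -> V) : strongly_measurable `[0, S] f ->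
  strongly_measurable box (fun z : R * R => f z.1).
Proof. by apply: strongly_measurable_comp => // z []. Qed.

Lemma strongly_measurable_snd (f : R -> V) : strongly_measurable `[0, T] f ->
  strongly_measurable box (fun z : R * R => f z.2).
Proof. by apply: strongly_measurable_comp => // z []. Qed.

Lemma strongly_measurable_min (f : R -> V) : strongly_measurable `[0, S] f ->
  strongly_measurable box (fun z : R * R => f (Num.min z.1 z.2)).
Proof.
apply: strongly_measurable_comp; first exact: measurable_minr.
move=> z [] /=; rewrite !in_itv/= => /andP[h1 h2] /andP[h3 _].
by rewrite le_min h1 h3/= ge_min h2.
Qed.

End measurable_rectangle.

Theorem theorem3p2 (R : realType) (H : hilbertType R) (S T : R)
    (L : H * H -> R) (x0 : H) :
  0 < S -> 0 < T ->
  ASD L -> (forall p : H, uniformly_convex (fun x : H => L (x, p))) ->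
  Dom1 L x0 ->
  exists (X : R -> L2 T H) (x xt xs : R -> R -> H),
    [/\ A2 S X,
        forall s, s \in `[0, S] -> represents (x s) (X s) &
        {ae lebesgue_measure, forall s : R, s \in `[0, S] -> A2 T (x s)}] /\
    [/\ strongly_measurable (`[0, S] `*` `[0, T]) (fun z : R * R => x z.1 z.2),
        strongly_measurable (`[0, S] `*` `[0, T]) (fun z : R * R => xt z.1 z.2) &
        strongly_measurable (`[0, S] `*` `[0, T]) (fun z : R * R => xs z.1 z.2)] /\
    {ae (lebesgue_measure \x lebesgue_measure)%E, forall z : R * R,
       z.1 \in `[0, S] -> z.2 \in `[0, T] ->
       is_derive z.2 1 (x z.1) (xt z.1 z.2)} /\
    {ae lebesgue_measure, forall s : R,
       s \in `[0, S] -> represents (xs s) (derive1 X s)} /\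
    (0 = \int[lebesgue_measure]_(s in `[0%R, S])
           \int[lebesgue_measure]_(t in `[0%R, T])
             (L (x s t, xt s t + xs s t))%:E
       + \int[lebesgue_measure]_(s in `[0%R, S])
           (2^-1 * `|x s 0| ^+ 2 - 2 * inner (x s 0) x0 + `|x0| ^+ 2
            + 2^-1 * `|x s T| ^+ 2)%:E
       + \int[lebesgue_measure]_(t in `[0%R, T])
           (2^-1 * `|x 0 t| ^+ 2 - 2 * inner (x 0 t) x0 + `|x0| ^+ 2
            + 2^-1 * `|x S t| ^+ 2)%:E)%E /\
    {ae (lebesgue_measure \x lebesgue_measure)%E, forall z : R * R,
       z.1 \in `[0, S] -> z.2 \in `[0, T] ->
       let v := xt z.1 z.2 + xs z.1 z.2 in
       subdiff1 (fun y => L (y, v)) (x z.1 z.2) (- v) /\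
       subdiff1 (fun q => L (x z.1 z.2, q)) v (- x z.1 z.2)} /\
    {ae lebesgue_measure, forall t : R, t \in `[0, T] -> x 0 t = x0} /\
    {ae lebesgue_measure, forall s : R, s \in `[0, S] -> x s 0 = x0}.
Proof.
move=> S0 T0 asdL _ [p0 /(subdiff_flow_graph asdL) G0].
have [y [d [C0 [cC0 [y0 Gy dN yN] yd0]]]] := evolution asdL G0.
(* The point 0 is added because [evolution] differentiates [y] at positive times only; to the left
   of 0 the curve is constant. *)
pose C := C0 `|` [set 0].
have cC : countable C by exact: countable_setU1.
have lemC : lebesgue_measure C = 0 by exact: countable_lebesgue_measure0.
have mC : measurable C by exact: countable_measurable.
have yd t : 0 <= t -> ~ C t -> is_derive t 1 y (d t).
  move=> t0 nCt; apply: yd0; last by move=> Ct; apply: nCt; left.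
  by rewrite lt_neqAle t0 andbT eq_sym; apply/eqP => tz; apply: nCt; right.
have {}yN : lipschitz_with `|p0| y by [].
exists (curve y T), (fun s t => y (Num.min s t)), (slope_t d C), (slope_s d C).
split.
  split.
  - apply: A2_lipschitz (ltW S0) (lipschitz_curve yN T0) cC _.
    move=> s /[!in_itv]/= /andP[s0 _] nCs.
    exact: (is_derive_curve yN yd T0 s0 nCs).
  - by move=> s _; apply: represents_toL2; exact: (L2fun_min yN T0 s).
  - apply: aeW => s _.
    apply: (A2_lipschitz (C := C `|` [set s]) (ltW T0) (lipschitz_min yN s)).
      exact: countable_setU1.
    move=> t /[!in_itv]/= /andP[t0 _] nC; apply: (is_derive_min yd) => //.
      by move=> Ct; apply: nC; left.
    by apply/eqP => ts; apply: nC; right.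
split.
  split.
  - apply: strongly_measurable_min; exact: (strongly_measurable_lipschitz S yN).
  - apply: (@strongly_measurable_eq _ _ _ _ _
      (fun z : R * R => \1_[set z : R * R | z.2 < z.1] z *: slope d C z.2)).
      by move=> z _; rewrite indicE mem_setE.
    apply: strongly_measurable_indic.
      exact: measurable_ltr_set.
    apply: strongly_measurable_snd; exact: (strongly_measurable_slope yN cC yd T).
  - apply: (@strongly_measurable_eq _ _ _ _ _
      (fun z : R * R => \1_[set z : R * R | z.1 < z.2] z *: slope d C z.1)).
      by move=> z _; rewrite indicE mem_setE.
    apply: strongly_measurable_indic; first exact: measurable_ltr_set.
    apply: strongly_measurable_fst; exact: (strongly_measurable_slope yN cC yd S).
have aeC := ae_product_off_countable cC.
split.
  apply: (@filterS _ _ (ae_filter_ringOfSetsType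
    (lebesgue_measure \x lebesgue_measure)%E)) aeC => z [_ nC2 n12] _ /[!in_itv]/= /andP[z0 _].
  by apply: (is_derive_min yd) => //; rewrite eq_sym.
split.
  exists C; split => // s /= ns; apply: contrapT => nCs; apply: ns.
  move=> /[!in_itv]/= /andP[s0 _].
  have [_ dE] := is_derive_curve yN yd T0 s0 nCs.
  rewrite derive1E dE; apply: represents_toL2.
  exact: (L2fun_slope yN yd T0 s0).
split; first exact: (energy_identity yN cC yd y0 Gy S0 T0).
split.
  apply: (@filterS _ _ (ae_filter_ringOfSetsType
    (lebesgue_measure \x lebesgue_measure)%E)) aeC => z [nC1 nC2 n12] _ _ /=.
  (* Testing the joint subgradient [(- v, - x)] with one component frozen gives the two partial
     inclusions. *)
  have /(flow_graph_subdiff asdL) sub := slope_sum_graph Gy nC1 nC2 n12.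
  split.
  - move=> w; have := sub (w, slope_t d C z.1 z.2 + slope_s d C z.1 z.2).
    by rewrite /= subrr linear0r addr0.
  - move=> q; have := sub (y (Num.min z.1 z.2), q).
    by rewrite /= subrr linear0r add0r.
split; apply: aeW => s /[!in_itv]/= /andP[s0 _].
  by rewrite min_l// y0.
by rewrite min_r// y0.
Qed.
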